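(* Let $(M,c)$ be a Riemannian conformal structure on a manifold $M$ of dimension $n\geq 2$, $g\in c$, $\alpha\colon\mathbb{R}\to\mathcal{T}_{(1,1)}M$ an admissible smooth $1$-parameter family, and $(\widetilde M,\widetilde g)$ the Lorentzian manifold constructed from $g$ and $\alpha$. For $u\in C^\infty(M)$ let $\Psi^u\colon M\to(\widetilde M,\widetilde g)$, $\Psi^u(x)=(e^{u(x)},0,x)$, with lightlike normal fields $\xi^u,\eta^u$. Then $\xi^u$ and $\eta^u$ are parallel with respect to the normal connection of $\Psi^u$. In particular, the normal curvature tensor of $\Psi^u$ vanishes, that is, $R^\perp(V,W)=0$ for every $V,W\in\mathfrak{X}(M)$.
   Context: Manifolds are smooth, Hausdorff, second countable, without boundary. A Riemannian conformal structure $(M,c)$ is an equivalence class $c$ of Riemannian metrics on $M$, where $g\sim g'$ iff $g'=e^{2u}g$ for some $u\in C^\infty(M)$. $\mathcal{T}_{(1,1)}M$ denotes the endomorphism fields of $TM$. $\nabla^gu$ is the $g$-gradient of $u$. Admissible family. A smooth $1$-parameter family $\alpha\colon\mathbb{R}\to\mathcal{T}_{(1,1)}M$ is admissible if each $\alpha(\rho)$ is self-adjoint with respect to any $g\in c$, $\alpha(0)=\mathrm{Id}$, and there is $\delta>0$ such that $\alpha(\rho)$ is nonsingular for $|\rho|<\delta$. Construction. $\widetilde M=\mathbb{R}^+\times(-\delta,\delta)\times M$ with coordinates $(t,\rho)$ on the first two factors, and $$\widetilde g=d(\rho t)\otimes dt+dt\otimes d(\rho t)+t^2\,g(\alpha(\rho)(-),-),$$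 a Lorentzian metric. The immersion $\Psi^u$ satisfies $(\Psi^u)^*\widetilde g=e^{2u}g$, and its normal bundle is spanned by the lightlike fields (with $\widetilde g(\xi^u,\eta^u)=-1$) $$\xi^u=e^u\partial_t|_{\Psi^u},\qquad \eta^u=e^{-u}\tfrac{\|\nabla^gu\|_g^2}{2}\,\partial_t|_{\Psi^u}-e^{-2u}\partial_\rho|_{\Psi^u}+e^{-2u}\nabla^gu|_{\Psi^u},$$ where a vector field on $M$ is identified with its natural lift to $\widetilde M$ and $X|_{\Psi^u}=X\circ\Psi^u$. Normal connection: $\nabla^\perp_V\zeta=(\widetilde\nabla_V\zeta)^\perp$ for $V\in\mathfrak{X}(M)$ and $\zeta$ normal, where $\widetilde\nabla$ is induced by the Levi-Civita connection of $\widetilde g$. Normal curvature: $R^\perp(V,W)\zeta=\nabla^\perp_V\nabla^\perp_W\zeta-\nabla^\perp_W\nabla^\perp_V\zeta-\nabla^\perp_{[V,W]}\zeta$. *)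

(* Defs.v *)
From HB Require Import structures.
From mathcomp Require Import all_boot all_order all_algebra.
From mathcomp Require Import all_classical all_reals all_analysis.

Set Implicit Arguments.
Unset Strict Implicit.
Unset Printing Implicit Defensive.

Import Order.TTheory GRing.Theory Num.Theory.
Import numFieldTopology.Exports numFieldNormedType.Exports.

Local Open Scope classical_set_scope.
Local Open Scope ring_scope.

(* C^k maps on an open set U: f is of class C^(k+1) iff it is differentiable on
   U and all its directional derivatives are of class C^k on U. *)
Fixpoint class_C (R : realType) (n : nat) (W : normedModType R) (k : nat)
    (U : set 'rV[R]_n) (f : 'rV[R]_n -> W) : Prop :=
  if k is k'.+1 then
    (forall y, U y -> differentiable f y) /\
    (forall v, class_C k' U ('D_v f))
  else forall y, U y -> {for y, continuous f}.

Definition smooth_on (R : realType) (n : nat) (W : normedModType R)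
    (U : set 'rV[R]_n) (f : 'rV[R]_n -> W) : Prop :=
  forall k, class_C k U f.

(* A smooth manifold given by an atlas. Chart i is the homeomorphism [chart_map i]
   from [chart_dom i] onto an open subset of R^n, with inverse [chart_inv i] (the values
   of [chart_map i] and [chart_inv i] outside these sets are irrelevant); [chart_at]
   selects a chart around each point. *)
Record manifold (R : realType) (n : nat) := Manifold {
  points :> topologicalType;
  chart : Type;
  chart_dom : chart -> set points;
  chart_map : chart -> points -> 'rV[R]_n;
  chart_inv : chart -> 'rV[R]_n -> points;
  chart_at : points -> chart;
  manifold_hausdorff : hausdorff_space points;
  manifold_second_countable : @second_countable points;
  chart_at_dom : forall p, chart_dom (chart_at p) p;
  chart_dom_open : forall i, open (chart_dom i);
  chart_map_open : forall i, open (chart_map i @` chart_dom i);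
  chart_mapK : forall i p, chart_dom i p -> chart_inv i (chart_map i p) = p;
  chart_map_continuous : forall i p, chart_dom i p -> {for p, continuous (chart_map i)};
  chart_inv_continuous : forall i y, (chart_map i @` chart_dom i) y ->
    {for y, continuous (chart_inv i)};
  transition_smooth : forall i j,
    smooth_on (chart_map i @` (chart_dom i `&` chart_dom j)) (chart_map j \o chart_inv i) }.

Arguments chart_dom {R n} _ _ _.
Arguments chart_map {R n} _ _ _.
Arguments chart_inv {R n} _ _ _.
Arguments chart_at {R n} _ _.

(* The tangent space at p is R^n, a vector being given by the row of its
   components in the chart [chart_at p]. So a bilinear form on T_p M is a matrix
   B, with B(v, w) = v *m B *m w^T, and an endomorphism of T_p M is a matrix A,
   with A(v) = v *m A. *)
Section Manifold.
Context {R : realType} {n : nat} (M : manifold R n).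

Definition vfield := M -> 'rV[R]_n.
Definition tensor02 := M -> 'M[R]_n.
Definition tensor11 := M -> 'M[R]_n.

(* v *m chart_change i j p has, in chart j, the components v has in chart i. *)
Definition chart_change (i j : chart M) (p : M) : 'M[R]_n :=
  jacobian (chart_map M j \o chart_inv M i) (chart_map M i p).

Definition coord_img (i : chart M) (U : set M) : set 'rV[R]_n :=
  chart_map M i @` (chart_dom M i `&` U).

Definition smooth_fun (U : set M) (f : M -> R) : Prop :=
  forall i, smooth_on (coord_img i U) (f \o chart_inv M i).

Definition vcomp (i : chart M) (X : vfield) (p : M) : 'rV[R]_n :=
  X p *m chart_change (chart_at M p) i p.

Definition smooth_vfield (U : set M) (X : vfield) : Prop :=
  forall i, smooth_on (coord_img i U) (vcomp i X \o chart_inv M i).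

Definition comp02 (i : chart M) (g : tensor02) (p : M) : 'M[R]_n :=
  chart_change i (chart_at M p) p *m g p *m (chart_change i (chart_at M p) p)^T.

Definition smooth_tensor02 (g : tensor02) : Prop :=
  forall i, smooth_on (coord_img i setT) (comp02 i g \o chart_inv M i).

Definition comp11 (i : chart M) (A : tensor11) (p : M) : 'M[R]_n :=
  chart_change i (chart_at M p) p *m A p *m chart_change (chart_at M p) i p.

(* Joint smoothness in the parameter r and the point. *)
Definition smooth_family (A : R -> tensor11) : Prop :=
  forall i, smooth_on
    [set z : 'rV[R]_(1 + n) | coord_img i setT (rsubmx z)]
    (fun z : 'rV[R]_(1 + n) =>
       comp11 i (A (lsubmx z 0 0)) (chart_inv M i (rsubmx z))).

Definition bform (B : 'M[R]_n) (v w : 'rV[R]_n) : R := (v *m B *m w^T) 0 0.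

(* The directional derivative of f at p, and the differential of f at p as a
   column: dir_derive f p v = v *m dfun f p. *)
Definition dir_derive (f : M -> R) (p : M) (v : 'rV[R]_n) : R :=
  'D_v (f \o chart_inv M (chart_at M p)) (chart_map M (chart_at M p) p).

Definition dfun (f : M -> R) (p : M) : 'cV[R]_n :=
  \col_k dir_derive f p (delta_mx 0 k).

(* [X, Y]^k = X(Y^k) - Y(X^k) in the chart at p. *)
Definition lie_bracket (X Y : vfield) : vfield := fun p =>
  let i := chart_at M p in
  'D_(X p) (vcomp i Y \o chart_inv M i) (chart_map M i p) -
  'D_(Y p) (vcomp i X \o chart_inv M i) (chart_map M i p).

Definition coord_vfield (i : chart M) (k : 'I_n) : vfield := fun p =>
  delta_mx 0 k *m chart_change i (chart_at M p) p.

Definition riemannian (g : tensor02) : Prop :=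
  [/\ smooth_tensor02 g, forall p, (g p)^T = g p &
      forall p v, v != 0 -> 0 < bform (g p) v v].

Definition conformal (g g' : tensor02) : Prop :=
  exists2 u : M -> R, smooth_fun setT u &
    forall p, g' p = expR (2 * u p) *: g p.

Definition conformal_structure (c : set tensor02) : Prop :=
  exists2 g, riemannian g & c = [set g' | riemannian g' /\ conformal g g'].

(* grad *m g p = (dfun u p)^T, i.e. g(grad, -) = du. *)
Definition gradient (g : tensor02) (u : M -> R) : vfield := fun p =>
  (dfun u p)^T *m invmx (g p).

Definition nonsingular_below (A : R -> tensor11) (delta : R) : Prop :=
  forall r, `|r| < delta -> forall p, A r p \in unitmx.

Definition admissible (c : set tensor02) (A : R -> tensor11) : Prop :=
  [/\ smooth_family A,
      forall g, c g -> forall r p v w,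
        bform (g p) (v *m A r p) w = bform (g p) v (w *m A r p),
      forall p, A 0 p = 1%:M &
      exists2 delta, 0 < delta & nonsingular_below A delta].

(* A connection is applied to fields which are smooth near the point where
   it is evaluated, i.e. it is viewed as an operator on germs of fields. *)
Definition connection := forall p : M, 'rV[R]_n -> vfield -> 'rV[R]_n.

Definition smooth_near_fun (p : M) (f : M -> R) : Prop :=
  exists2 U, open_nbhs p U & smooth_fun U f.

Definition smooth_near_vfield (p : M) (X : vfield) : Prop :=
  exists2 U, open_nbhs p U & smooth_vfield U X.

Definition affine_connection (D : connection) : Prop :=
  [/\ forall p X, smooth_near_vfield p X ->
        forall (a : R) v w, D p (a *: v + w) X = a *: D p v X + D p w X,
      forall p v X Y, smooth_near_vfield p X -> smooth_near_vfield p Y ->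
        D p v (fun q => X q + Y q) = D p v X + D p v Y,
      forall p v f X, smooth_near_fun p f -> smooth_near_vfield p X ->
        D p v (fun q => f q *: X q) = dir_derive f p v *: X p + f p *: D p v X
    & forall U X Y, open U -> smooth_vfield U X -> smooth_vfield U Y ->
        smooth_vfield U (fun p => D p (X p) Y)].

Definition torsion_free (D : connection) : Prop :=
  forall p X Y, smooth_near_vfield p X -> smooth_near_vfield p Y ->
    D p (X p) Y - D p (Y p) X = lie_bracket X Y p.

Definition metric_compatible (g : tensor02) (D : connection) : Prop :=
  forall p v X Y, smooth_near_vfield p X -> smooth_near_vfield p Y ->
    dir_derive (fun q => bform (g q) (X q) (Y q)) p v =
    bform (g p) (D p v X) (Y p) + bform (g p) (X p) (D p v Y).

Definition levi_civita (g : tensor02) (D : connection) : Prop :=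
  [/\ affine_connection D, torsion_free D & metric_compatible g D].

End Manifold.

Section Immersion.
Context {R : realType} {n m : nat} (M : manifold R n) (N : manifold R m).
Variables (g : tensor02 N) (D : connection N) (Psi : M -> N).

(* dPsi_x(v) = v *m differential x *)
Definition differential (x : M) : 'M[R]_(n, m) :=
  jacobian (chart_map N (chart_at N (Psi x)) \o Psi \o chart_inv M (chart_at M x))
    (chart_map M (chart_at M x) x).

(* Fields along Psi: Z x is a tangent vector of N at Psi x. *)
Definition field_along := M -> 'rV[R]_m.

Definition acomp (j : chart N) (Z : field_along) (x : M) : 'rV[R]_m :=
  Z x *m chart_change (chart_at N (Psi x)) j (Psi x).

Definition smooth_along (Z : field_along) : Prop :=
  forall i j, smooth_on (coord_img i (Psi @^-1` chart_dom N j))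
    (acomp j Z \o chart_inv M i).

(* The pullback connection: expanding Z = \sum_k Z^k E_k o Psi in the
   coordinate frame (E_k) around Psi x, the derivative of Z along v is
   \sum_k (v(Z^k) E_k + Z^k D_{dPsi v} E_k). *)
Definition pullback_connection (x : M) (v : 'rV[R]_n) (Z : field_along) :
    'rV[R]_m :=
  let i := chart_at M x in let j := chart_at N (Psi x) in
  'D_v (acomp j Z \o chart_inv M i) (chart_map M i x) +
  \sum_k Z x 0 k *: D (Psi x) (v *m differential x) (coord_vfield j k).

(* The row spaces of these two matrices are the tangent and the normal space
   of Psi at x, as subspaces of T_(Psi x) N. *)
Definition tangent_space (x : M) : 'M[R]_m := <<differential x>>%MS.
Definition normal_space (x : M) : 'M[R]_m :=
  kermx (g (Psi x) *m (differential x)^T).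

Definition normal_part (x : M) (w : 'rV[R]_m) : 'rV[R]_m :=
  w *m proj_mx (normal_space x) (tangent_space x).

Definition normal_field (Z : field_along) : Prop :=
  forall x, (Z x <= normal_space x)%MS.

Definition normal_connection (V : vfield M) (Z : field_along) : field_along :=
  fun x => normal_part x (pullback_connection x (V x) Z).

Definition normal_parallel (Z : field_along) : Prop :=
  forall V, smooth_vfield setT V -> forall x, normal_connection V Z x = 0.

Definition normal_curvature (V W : vfield M) (Z : field_along) : field_along :=
  fun x => normal_connection V (normal_connection W Z) x
         - normal_connection W (normal_connection V Z) x
         - normal_connection (lie_bracket V W) Z x.

End Immersion.

Lemma near_eq_diff (R : realType) (V W : normedModType R) (f h : V -> W) (y : V) :
  {near y, f =1 h} -> differentiable f y -> differentiable h y.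
Proof.
move=> fh df.
have fhy : f y = h y by exact: nbhs_singleton fh.
have [cd ed] := (diff_locallyP _ _).1 df.
have E : h \o shift y = cst (h y) + ('d f y : V -> W) +o_ (0 : V) id.
  apply/eqaddoP => e e0.
  move/eqaddoP : ed => /(_ e e0) ed.
  have /nbhs0P fh0 : \forall z \near y, f z = h z by exact: fh.
  near=> z.
  have -> : (h \o shift y - (cst (h y) + ('d f y : V -> W))) z =
            (f \o shift y - (cst (f y) + ('d f y : V -> W))) z.
    rewrite /= /cst -fhy !fctE /=. congr (_ - _); rewrite addrC; apply/esym; near: z; exact: fh0.
  by near: z.
have e := diff_unique cd E.
by apply/diff_locallyP; rewrite e.
Unshelve. all: by end_near. Qed.

Lemma continuous_at_mx (R : realType) (T : topologicalType) p q
    (F : T -> 'M[R]_(p, q)) (t : T) :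
  (forall i j, {for t, continuous (fun s => F s i j)}) -> {for t, continuous F}.
Proof.
move=> cF A [P nP PA].
suff : \forall s \near t, forall i j, P i j (F s i j).
  by apply: filterS => s Ps; exact: PA.
by apply: filter_forall => i; apply: filter_forall => j; exact: cF.
Qed.

Lemma continuous_mx (R : realType) (T : topologicalType) p q
    (F : T -> 'M[R]_(p, q)) :
  (forall i j, continuous (fun t => F t i j)) -> continuous F.
Proof. by move=> cF t; apply: continuous_at_mx => i j; exact: cF. Qed.

Section Smooth.
Context {R : realType}.

Lemma class_C_ext n (W : normedModType R) k (U : set 'rV[R]_n)
    (f h : 'rV[R]_n -> W) : open U -> (forall y, U y -> f y = h y) ->
  class_C k U f -> class_C k U h.
Proof.
move=> oU; elim: k f h => [|k IH] f h fh /=.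
  move=> cf y Uy; have nfh : {near y, f =1 h}.
    by near=> z; apply: fh; near: z; exact: open_nbhs_nbhs.
  rewrite /prop_for /continuous_at -(fh _ Uy).
  apply: cvg_trans (cf y Uy); exact: near_eq_cvg nfh.
move=> [df Df]; split.
  move=> y Uy; have nfh : {near y, f =1 h}.
    by near=> z; apply: fh; near: z; exact: open_nbhs_nbhs.
  exact: near_eq_diff nfh (df y Uy).
move=> v; apply: IH (Df v) => y Uy.
apply: near_eq_derive.
by near=> z; apply: fh; near: z; exact: open_nbhs_nbhs.
Unshelve. all: by end_near. Qed.

Lemma class_C_cst n (W : normedModType R) k (U : set 'rV[R]_n) (w : W) :
  class_C k U (cst w).
Proof.
elim: k w => [|k IH] w /=; first by move=> y _; exact: cst_continuous.
split=> [y _|v]; first exact: differentiable_cst.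
rewrite (_ : 'D_v (cst w) = cst 0); first exact: IH.
by apply/funext => y; rewrite derive_cst.
Qed.

Lemma class_C_id n k (U : set 'rV[R]_n) : class_C k U (@id 'rV[R]_n).
Proof.
case: k => [|k] /=; first by move=> y _.
split=> [y _|v]; first exact: ex_diff.
rewrite (_ : 'D_v id = cst v); first exact: class_C_cst.
by apply/funext => y; rewrite derive_id.
Qed.

Lemma class_C_lin n (W W' : normedModType R) k (U : set 'rV[R]_n)
    (L : {linear W -> W'}) (f : 'rV[R]_n -> W) :
  open U -> continuous L -> class_C k U f -> class_C k U (L \o f).
Proof.
move=> oU cL; elim: k f => [|k IH] f /=.
  by move=> cf y Uy; apply: continuous_comp; [exact: cf|exact: cL].
move=> [df Df]; split=> [y Uy|v].
  apply: differentiable_comp; first exact: df.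
  exact: linear_differentiable.
apply: class_C_ext (IH _ (Df v)) => // y Uy /=.
have dL w : differentiable L w by exact: linear_differentiable.
have dLf : differentiable (L \o f) y by apply: differentiable_comp; [exact: df|].
rewrite (deriveE _ dLf) (deriveE _ (df _ Uy)) (diff_comp (df _ Uy) (dL _)).
exact: (esym (congr1 (fun F => F ('d f y v)) (diff_lin (f y) cL))).
Qed.

Lemma class_CD n (W : normedModType R) k (U : set 'rV[R]_n)
    (f h : 'rV[R]_n -> W) :
  open U -> class_C k U f -> class_C k U h -> class_C k U (f \+ h).
Proof.
move=> oU; elim: k f h => [|k IH] f h /=.
  by move=> cf ch y Uy; exact: continuousD (cf y Uy) (ch y Uy).
move=> [df Df] [dh Dh]; split=> [y Uy|v].
  by apply: differentiableD; [exact: df|exact: dh].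
apply: class_C_ext (IH _ _ (Df v) (Dh v)) => // y Uy /=.
by rewrite deriveD; [|apply/diff_derivable/df|apply/diff_derivable/dh].
Qed.

Lemma class_C_rsubmx p n (W : normedModType R) k (U : set 'rV[R]_n)
    (h : 'rV[R]_n -> W) : open U -> class_C k U h ->
  class_C k [set z : 'rV[R]_(p + n) | U (rsubmx z)]
    (fun z : 'rV[R]_(p + n) => h (rsubmx z)).
Proof.
move=> oU; have oU' : open [set z : 'rV[R]_(p + n) | U (rsubmx z)].
  apply: (open_comp (f := @rsubmx R 1 p n)) oU => z _; exact: continuous_rsubmx.
elim: k h => [|k IH] h /=.
  move=> ch z Uz; apply: continuous_comp; first exact: continuous_rsubmx.
  exact: ch.
move=> [dh Dh]; split=> [z Uz|v].
  apply: differentiable_comp; first exact: differentiable_rsubmx.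
  exact: dh.
apply: class_C_ext (IH _ (Dh (rsubmx v))) => // z Uz /=.
have dr := @differentiable_rsubmx R 1 p n z.
have dhr : differentiable (fun z : 'rV[R]_(p + n) => h (rsubmx z)) z.
  by apply: differentiable_comp => //; exact: dh.
rewrite (deriveE _ dhr) (deriveE _ (dh _ Uz)).
rewrite (diff_comp dr (dh _ Uz)).
have := congr1 (fun F => F v) (diff_lin z (@continuous_rsubmx R 1 p n)).
by move=> /= ->.
Qed.

Lemma class_C_row_mx n p q k (U : set 'rV[R]_n) (f : 'rV[R]_n -> 'rV[R]_p)
    (h : 'rV[R]_n -> 'rV[R]_q) : open U -> class_C k U f -> class_C k U h ->
  class_C k U (fun z => row_mx (f z) (h z)).
Proof.
move=> oU cf ch.
pose A : 'M[R]_(p, p + q) := row_mx 1%:M 0.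
pose B : 'M[R]_(q, p + q) := row_mx 0 1%:M.
have cA : continuous (mulmxr A : 'rV_p -> 'rV_(p + q)).
  apply: continuous_mx => i j.
  rewrite (_ : (fun _ => _) = fun w : 'rV[R]_p =>
    match fintype.split j with inl l => w i l | inr l => (0 : 'rV[R]_q) i l end).
    by case: (fintype.split j) => l; [exact: coord_continuous|exact: cst_continuous].
  by apply/funext => w; rewrite /= mul_mx_row mulmx1 mulmx0 mxE.
have cB : continuous (mulmxr B : 'rV_q -> 'rV_(p + q)).
  apply: continuous_mx => i j.
  rewrite (_ : (fun _ => _) = fun w : 'rV[R]_q =>
    match fintype.split j with inl l => (0 : 'rV[R]_p) i l | inr l => w i l end).
    by case: (fintype.split j) => l; [exact: cst_continuous|exact: coord_continuous].
  by apply/funext => w; rewrite /= mul_mx_row mulmx1 mulmx0 mxE.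
apply: class_C_ext (class_CD oU (class_C_lin oU cA cf)
  (class_C_lin oU cB ch)) => // y _ /=.
by rewrite !mul_mx_row !mulmx1 !mulmx0 add_row_mx addr0 add0r.
Qed.

End Smooth.

Section Topology.

Lemma hausdorff_prod (T U : topologicalType) : hausdorff_space T ->
  hausdorff_space U -> hausdorff_space (T * U)%type.
Proof.
move=> hT hU [x1 x2] [y1 y2] xy; congr pair.
- apply: hT => A B Ax By.
  have [||z [[Az _] [Bz _]]] := xy (A `*` setT) (B `*` setT).
  + by exists (A, setT) => //=; split => //; exact: filterT.
  + by exists (B, setT) => //=; split => //; exact: filterT.
  by exists z.1.
- apply: hU => A B Ax By.
  have [||z [[_ Az] [_ Bz]]] := xy (setT `*` A) (setT `*` B).
  + by exists (setT, A) => //=; split => //; exact: filterT.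
  + by exists (setT, B) => //=; split => //; exact: filterT.
  by exists z.2.
Qed.

Lemma hausdorff_set_type (T : topologicalType) (S : set T) :
  hausdorff_space T -> hausdorff_space S.
Proof.
move=> hT x y xy; apply: val_inj; apply: hT => A B Ax By.
have [||z [Az Bz]] := xy (set_val @^-1` A) (set_val @^-1` B).
- exact: (@initial_continuous S T set_val x).
- exact: (@initial_continuous S T set_val y).
by exists (set_val z).
Qed.

Lemma second_countable_prod (T U : topologicalType) :
  @second_countable T -> @second_countable U ->
  @second_countable (T * U)%type.
Proof.
move=> [B cB [oB bB]] [C cC [oC bC]].
exists [set P | exists2 p, (B `*` C) p & P = p.1 `*` p.2].
  rewrite (_ : mkset _ = (fun p => p.1 `*` p.2) @` (B `*` C)).
    exact: sub_countable (card_image_le _ _) (countableX cB cC).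
  by apply/seteqP; split=> P [p Bp e]; exists p.
split=> [_ [[P Q] [/= BP CQ] ->]|[x y] A].
  rewrite openE => -[a b] [/= Pa Qb]; exists (P, Q) => //=; split.
    exact: open_nbhs_nbhs (conj (oB _ BP) Pa).
  exact: open_nbhs_nbhs (conj (oC _ CQ) Qb).
move=> [[P Q] /= [Px Qy] PQA].
have [P' [BP' P'x] sP] := bB x P Px.
have [Q' [CQ' Q'y] sQ] := bC y Q Qy.
exists (P' `*` Q'); first by split=> //; exists (P', Q').
by move=> z [/sP ? /sQ ?]; exact: PQA.
Qed.

Lemma second_countable_set_type (T : topologicalType) (S : set T) :
  @second_countable T -> @second_countable S.
Proof.
move=> [B cB [oB bB]].
exists ((fun A : set T => set_val @^-1` A : set S) @` B).
  exact: sub_countable (card_image_le _ _) cB.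
split=> [_ [A BA <-]|x A].
  by exists A => //; exact: oB.
move=> [_ [[C oC <-] Cx] CA].
have [P [BP Px] sP] := bB (set_val x) C (open_nbhs_nbhs (conj oC Cx)).
exists (set_val @^-1` P); first by split=> //; exists P.
by move=> z /= /sP; exact: CA.
Qed.

Lemma second_countable_real (R : realType) : @second_countable R.
Proof.
exists [set P : set R | exists p : rat * rat, P = `](ratr p.1), (ratr p.2)[%classic].
  rewrite (_ : mkset _ = (fun p : rat * rat =>
    `](ratr p.1), (ratr p.2)[%classic) @` setT).
    exact: sub_countable (card_image_le _ _) (countableP _).
  by apply/seteqP; split=> P [p] => [->|_ <-]; [exists p|exists p].
split=> [_ [p ->]|x A]; first exact: interval_open.
move=> /nbhs_ballP [e /= e0 eA].
have [p] : exists p, ratr p \in `](x - e), x[ .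
  by apply: rat_in_itvoo; rewrite ltrBlDr ltrDl.
have [q] : exists p, ratr p \in `]x, (x + e)[ .
  by apply: rat_in_itvoo; rewrite ltrDl.
rewrite !in_itv /= => /andP[xq qe] /andP[ep px].
exists (`](ratr p), (ratr q)[%classic).
  by split; [exists (p, q)|rewrite /= in_itv /= px xq].
move=> z /=; rewrite in_itv /= => /andP[pz zq]; apply: eA.
rewrite /ball /= ltr_distlC.
by rewrite (lt_trans ep pz) (lt_trans zq qe).
Qed.

End Topology.

Lemma class_C_sub (R : realType) n (W : normedModType R) k (U V : set 'rV[R]_n)
    (f : 'rV[R]_n -> W) : V `<=` U -> class_C k U f -> class_C k V f.
Proof.
move=> VU; elim: k f => [|k IH] f /= => [cf y /VU|[df Df]]; first exact: cf.
by split=> [y /VU|v]; [exact: df|exact: IH].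
Qed.

Section Ambient.
Context {R : realType} {n : nat} (M : manifold R n) (delta : {posnum R}).

(* (0, +oo) x (-delta, delta) x M, with coordinates (t, r, x). *)
Definition ambient_set : set (R * R * M) :=
  [set p | 0 < p.1.1 /\ `|p.1.2| < delta%:num].

Definition ambient_points : topologicalType := set_type ambient_set.

Definition tcoord (p : ambient_points) : R := (\val p).1.1.
Definition rcoord (p : ambient_points) : R := (\val p).1.2.
Definition mproj (p : ambient_points) : M := (\val p).2.

Lemma ambient_slice0_subproof (t : R) (x : M) :
  0 < t -> (t, 0, x) \in ambient_set.
Proof. by move=> t0; apply/mem_set; split => //=; rewrite normr0. Qed.

Definition ambient_slice0 (t : R) (t0 : 0 < t) (x : M) : ambient_points :=
  exist _ (t, 0, x) (ambient_slice0_subproof x t0).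

Definition ambient_dom (i : chart M) : set ambient_points :=
  [set p | chart_dom M i (mproj p)].

Definition ambient_coord (i : chart M) (p : ambient_points) : 'rV[R]_(2 + n) :=
  row_mx (\row_(k < 2) [:: tcoord p; rcoord p]`_k) (chart_map M i (mproj p)).

(* Outside of the image of ambient_coord i this is an arbitrary point. *)
Definition ambient_param (i : chart M) (z : 'rV[R]_(2 + n)) : ambient_points :=
  let x := chart_inv M i (rsubmx z) in
  insubd (ambient_slice0 ltr01 x) (lsubmx z 0 0, lsubmx z 0 1, x).

Definition ambient_chart_at (p : ambient_points) : chart M :=
  chart_at M (mproj p).

Lemma ambient_ext (p q : ambient_points) :
  tcoord p = tcoord q -> rcoord p = rcoord q -> mproj p = mproj q -> p = q.
Proof.
rewrite /tcoord /rcoord /mproj => e1 e2 e3; apply: val_inj.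
by case: (\val p) e1 e2 e3 => [[? ?] ?]; case: (\val q) => [[? ?] ?] /= -> -> ->.
Qed.

Lemma tcoord_gt0 p : 0 < tcoord p.
Proof. by have [] := set_mem (valP p). Qed.

Lemma rcoord_lt p : `|rcoord p| < delta%:num.
Proof. by have [] := set_mem (valP p). Qed.

Lemma ambient_val_continuous :
  continuous (fun p : ambient_points => \val p : R * R * M).
Proof. exact: (@initial_continuous ambient_set _ set_val). Qed.

Lemma tcoord_continuous : continuous tcoord.
Proof.
move=> p; apply: (@continuous_comp _ _ _ (fun p : ambient_points => \val p)
  (fun q : R * R * M => q.1.1)); first exact: ambient_val_continuous.
by apply: (@continuous_comp _ _ _ fst fst); exact: cvg_fst.
Qed.

Lemma rcoord_continuous : continuous rcoord.
Proof.
move=> p; apply: (@continuous_comp _ _ _ (fun p : ambient_points => \val p)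
  (fun q : R * R * M => q.1.2)); first exact: ambient_val_continuous.
by apply: (@continuous_comp _ _ _ fst snd); [exact: cvg_fst|exact: cvg_snd].
Qed.

Lemma mproj_continuous : continuous mproj.
Proof.
move=> p; apply: (@continuous_comp _ _ _ (fun p : ambient_points => \val p)
  (fun q : R * R * M => q.2)); first exact: ambient_val_continuous.
exact: cvg_snd.
Qed.

Definition ambient_box : set 'rV[R]_(2 + n) :=
  [set z | 0 < lsubmx z 0 0 /\ `|lsubmx z 0 1| < delta%:num].

Lemma ambient_paramE i z : ambient_box z ->
  [/\ tcoord (ambient_param i z) = lsubmx z 0 0,
      rcoord (ambient_param i z) = lsubmx z 0 1 &
      mproj (ambient_param i z) = chart_inv M i (rsubmx z)].
Proof.
move=> bz; rewrite /tcoord /rcoord /mproj /ambient_param val_insubd.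
by rewrite (_ : _ \in _ = true) //; apply/mem_set.
Qed.

Lemma ambient_coord_box i p : ambient_box (ambient_coord i p).
Proof.
rewrite /ambient_box /= row_mxKl !mxE /=.
by split; [exact: tcoord_gt0|exact: rcoord_lt].
Qed.

Lemma ambient_coordK i p :
  ambient_dom i p -> ambient_param i (ambient_coord i p) = p.
Proof.
move=> ip; have [e1 e2 e3] := ambient_paramE i (ambient_coord_box i p).
apply: ambient_ext; [rewrite e1|rewrite e2|rewrite e3].
- by rewrite row_mxKl mxE.
- by rewrite row_mxKl mxE.
- by rewrite row_mxKr chart_mapK.
Qed.

Lemma ambient_paramK i z : ambient_box z -> (chart_map M i @` chart_dom M i) (rsubmx z) ->
  ambient_coord i (ambient_param i z) = z.
Proof.
move=> bz [x ix xz]; have [e1 e2 e3] := ambient_paramE i bz.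
rewrite /ambient_coord e1 e2 e3 -xz chart_mapK // xz -[RHS]hsubmxK.
congr row_mx; apply/rowP => k; rewrite mxE.
by case: k => [[|[|//]] kP] /=; congr (lsubmx z _ _); exact/val_inj.
Qed.

Lemma ambient_imgE i (U : set M) : U `<=` chart_dom M i ->
  ambient_coord i @` (mproj @^-1` U) =
  ambient_box `&` [set z | (chart_map M i @` U) (rsubmx z)].
Proof.
move=> Ui; apply/seteqP; split=> z.
  move=> [p Up <-]; split; first exact: ambient_coord_box.
  by rewrite /= row_mxKr; exists (mproj p).
move=> [bz [x Ux xz]]; exists (ambient_param i z).
  have [_ _ e3] := ambient_paramE i bz.
  by rewrite /= e3 -xz chart_mapK //; exact: Ui.
by apply: ambient_paramK => //; exists x => //; exact: Ui.
Qed.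

Lemma ambient_box_open : open ambient_box.
Proof.
have c k : continuous (fun z : 'rV[R]_(2 + n) => lsubmx z 0 k).
  move=> z; apply: (@continuous_comp _ _ _ lsubmx (fun w : 'rV[R]_2 => w 0 k)).
    exact: continuous_lsubmx.
  exact: coord_continuous.
apply: openI.
  apply: (open_comp (f := fun z : 'rV[R]_(2 + n) => lsubmx z 0 0)
    (D := [set t | 0 < t])); last exact: open_gt.
  by move=> z _; exact: c.
apply: (open_comp (f := fun z : 'rV[R]_(2 + n) => `|lsubmx z 0 1|)
  (D := [set t | t < delta%:num])); last exact: open_lt.
move=> z _; apply: continuous_comp; first exact: c.
exact: norm_continuous.
Qed.

Lemma open_rsubmx (U : set 'rV[R]_n) :
  open U -> open [set z : 'rV[R]_(2 + n) | U (rsubmx z)].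
Proof.
by apply: open_comp => z _; exact: continuous_rsubmx.
Qed.

Fact ambient_hausdorff : hausdorff_space ambient_points.
Proof.
apply: hausdorff_set_type; apply: hausdorff_prod; last exact: manifold_hausdorff.
by apply: hausdorff_prod; exact: Rhausdorff.
Qed.

Fact ambient_second_countable : @second_countable ambient_points.
Proof.
apply: second_countable_set_type; apply: second_countable_prod.
  by apply: second_countable_prod; exact: second_countable_real.
exact: manifold_second_countable.
Qed.

Fact ambient_dom_chart_at p : ambient_dom (ambient_chart_at p) p.
Proof. exact: chart_at_dom. Qed.

Fact ambient_dom_open i : open (ambient_dom i).
Proof.
apply: (open_comp (f := mproj)); last exact: chart_dom_open.
by move=> p _; exact: mproj_continuous.
Qed.

Fact ambient_coord_open i : open (ambient_coord i @` ambient_dom i).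
Proof.
rewrite (ambient_imgE (U := chart_dom M i)) //.
apply: openI; first exact: ambient_box_open.
exact/open_rsubmx/chart_map_open.
Qed.

Fact ambient_coord_continuous i p :
  ambient_dom i p -> {for p, continuous (ambient_coord i)}.
Proof.
move=> ip; apply: continuous_at_mx => a b.
rewrite (_ : (fun _ => _) = fun q : ambient_points =>
  match fintype.split b with
  | inl l => [:: tcoord q; rcoord q]`_l
  | inr l => chart_map M i (mproj q) a l
  end); last by apply/funext => q; rewrite mxE; case: fintype.split => // l; rewrite mxE.
case: (fintype.split b) => [[[|[|//]] lP] /=|l].
- exact: tcoord_continuous.
- exact: rcoord_continuous.
apply: (@continuous_comp _ _ _ (fun q => chart_map M i (mproj q))
  (fun w : 'rV[R]_n => w a l)); last exact: coord_continuous.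
apply: continuous_comp; first exact: mproj_continuous.
exact: (chart_map_continuous ip).
Qed.

Fact ambient_param_continuous i z : (ambient_coord i @` ambient_dom i) z ->
  {for z, continuous (ambient_param i)}.
Proof.
rewrite (ambient_imgE (U := chart_dom M i)) // => -[bz cz].
move=> A [_ [[C oC <-] Cz] CA].
pose F (w : 'rV[R]_(2 + n)) : R * R * M :=
  (lsubmx w 0 0, lsubmx w 0 1, chart_inv M i (rsubmx w)).
have valE w : ambient_box w -> \val (ambient_param i w) = F w.
  by move=> bw; rewrite val_insubd (_ : _ \in _ = true) //; apply/mem_set.
have cl k : {for z, continuous (fun w : 'rV[R]_(2 + n) => lsubmx w 0 k)}.
  apply: (@continuous_comp _ _ _ lsubmx (fun w : 'rV[R]_2 => w 0 k)).
    exact: continuous_lsubmx.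
  exact: coord_continuous.
have cr : {for z, continuous (fun w : 'rV[R]_(2 + n) => chart_inv M i (rsubmx w))}.
  apply: continuous_comp; first exact: continuous_rsubmx.
  exact: chart_inv_continuous.
have cF : {for z, continuous F}.
  exact: (cvg_pair (cvg_pair (cl 0) (cl 1)) cr).
have CF : \forall w \near z, C (F w).
  by apply: cF; apply: open_nbhs_nbhs; split=> //; rewrite -valE.
have bF : \forall w \near z, ambient_box w.
  by apply: open_nbhs_nbhs; split=> //; exact: ambient_box_open.
apply: filterS2 CF bF => w Cw bw; apply: CA.
by rewrite /= /set_val /= valE.
Qed.

Lemma coord_img_open i (U : set M) : open U -> open (chart_map M i @` (chart_dom M i `&` U)).
Proof.
move=> oU; rewrite openE => _ [p [ip Up] <-].
have cp : (chart_map M i @` chart_dom M i) (chart_map M i p) by exists p.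
have n1 : nbhs (chart_map M i p) (chart_map M i @` chart_dom M i).
  by apply: open_nbhs_nbhs; split=> //; exact: chart_map_open.
have n2 : nbhs (chart_map M i p) (chart_inv M i @^-1` U).
  apply: (chart_inv_continuous cp); rewrite chart_mapK //.
  exact: (open_nbhs_nbhs (conj oU Up)).
apply: filterS2 n1 n2 => _ [q iq <-] Uq; exists q => //; split=> //.
by rewrite /= chart_mapK in Uq.
Qed.

Fact ambient_transition_smooth i j :
  smooth_on (ambient_coord i @` (ambient_dom i `&` ambient_dom j))
    (ambient_coord j \o ambient_param i).
Proof.
have -> : ambient_dom i `&` ambient_dom j = mproj @^-1` (chart_dom M i `&` chart_dom M j).
  by [].
rewrite ambient_imgE; last by move=> x [].
set U := chart_map M i @` _ => k.
have oU : open U by exact/coord_img_open/chart_dom_open.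
have oV : open (ambient_box `&` [set z | U (rsubmx z)]).
  by apply: openI; [exact: ambient_box_open|exact: open_rsubmx].
apply: (class_C_ext (f := fun z : 'rV[R]_(2 + n) =>
  row_mx (lsubmx z) ((chart_map M j \o chart_inv M i) (rsubmx z)))) => //.
  move=> z [bz [x [ix jx] xz]].
  have [e1 e2 e3] := ambient_paramE i bz.
  rewrite /= /ambient_coord e1 e2 e3; congr row_mx.
  apply/rowP => l; rewrite [RHS]mxE.
  by case: l => [[|[|//]] kP] /=; congr (lsubmx z _ _); exact/val_inj.
apply: class_C_row_mx => //.
  apply: (class_C_lin (L := lsubmx) (f := id)) => //.
    exact: continuous_lsubmx.
  exact: class_C_id.
apply: class_C_sub
  (class_C_rsubmx 2 oU (@transition_smooth _ _ M i j k)).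
by move=> z [].
Qed.

Definition ambient : manifold R (2 + n) :=
  @Manifold R (2 + n) ambient_points (chart M) ambient_dom ambient_coord
    ambient_param ambient_chart_at ambient_hausdorff ambient_second_countable
    ambient_dom_chart_at ambient_dom_open ambient_coord_open ambient_coordK
    ambient_coord_continuous ambient_param_continuous ambient_transition_smooth.

End Ambient.

Section Construction.
Context {R : realType} {n : nat} (M : manifold R n) (delta : {posnum R}).
Variables (g : tensor02 M) (alpha : R -> tensor11 M) (u : M -> R).

(* At (t, r, x) the tangent space is R^2 x T_x M. *)
Definition partial_t : 'rV[R]_(2 + n) := row_mx (delta_mx 0 0) 0.
Definition partial_r : 'rV[R]_(2 + n) := row_mx (delta_mx 0 1) 0.
Definition lift_vect (v : 'rV[R]_n) : 'rV[R]_(2 + n) := row_mx 0 v.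

(* d(rt) (x) dt + dt (x) d(rt) + t^2 g(alpha(r) -, -) *)
Definition ambient_metric : tensor02 (ambient M delta) := fun p =>
  let dt : 'cV[R]_(2 + n) := dfun (M := ambient M delta) (@tcoord _ _ _ _) p in
  let drt : 'cV[R]_(2 + n) :=
    dfun (M := ambient M delta) (fun q => rcoord q * tcoord q) p in
  drt *m dt^T + dt *m drt^T +
  tcoord p ^+ 2 *:
    block_mx 0 0 0 (alpha (rcoord p) (mproj p) *m g (mproj p)).

Definition Psi (x : M) : ambient M delta :=
  ambient_slice0 delta (expR_gt0 (u x)) x.

Definition xi_field : M -> 'rV[R]_(2 + n) := fun x => expR (u x) *: partial_t.

Definition eta_field : M -> 'rV[R]_(2 + n) := fun x =>
  let grad := gradient g u x in
  (expR (- u x) * (bform (g x) grad grad / 2)) *: partial_t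
  - expR (- 2 * u x) *: partial_r
  + expR (- 2 * u x) *: lift_vect grad.

End Construction.

Arguments ambient_metric {R n M} delta g alpha _.
Arguments Psi {R n M} delta u _.

(* Main.v *)
(** The field t d_t of the ambient space is homothetic: D_v (t d_t) = v for
    every v, by the Koszul formula. It restricts to xi along the immersion, so
    the covariant derivative of xi along v is d Psi(v), which is tangent: xi is
    parallel. As xi and eta are lightlike with g(xi, eta) = -1, metric
    compatibility then gives g(D_v eta, eta) = 0 and
    g(D_v eta, xi) = - g(eta, d Psi(v)) = 0, so eta is parallel as well. A
    normal field is Z = a xi + b eta with a = - g(Z, eta), b = - g(Z, xi)
    smooth; the normal connection thus acts by differentiating a and b, and
    the curvature vanishes because second derivatives commute. *)

Require Import Defs.
From HB Require Import structures.
From mathcomp Require Import all_boot all_order all_algebra.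
From mathcomp Require Import all_classical all_reals all_analysis.
From mathcomp Require Import ring lra.

Set Implicit Arguments.
Unset Strict Implicit.
Unset Printing Implicit Defensive.

Import Order.TTheory GRing.Theory Num.Theory.
Import numFieldTopology.Exports numFieldNormedType.Exports.

Local Open Scope classical_set_scope.
Local Open Scope ring_scope.

(** * Calculus of smooth maps *)

(** [D] is known only through the axioms of [levi_civita], which speak of fields smooth near a
    point, so there is no explicit formula for it to start from. The test fields are those with
    constant components in one chart: their brackets vanish, and torsion-freeness with compatibility
    becomes a linear system for the pairings of [D]. Of the metric only two kinds of derivatives
    enter, those of pairings with d_t and those along d_t. The first do not see [alpha], and in the
    second [alpha] is constant, so [alpha] is never differentiated there. Its invertibility serves
    to recover a vector from its pairings.

    A tangent vector at [p] is stored in the chart [chart_at p], which may jump from point to point.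
    A field therefore has to be rewritten in one fixed chart before it is differentiated, and
    coordinate identities hold only near the point. Fields along the immersion need not come from
    ambient fields, so compatibility along it is a statement of its own, proved by the product rule
    for Z G W^T. *)

Lemma addmx00 (R : nmodType) (A B : 'M[R]_1) : (A + B) 0 0 = A 0 0 + B 0 0.
Proof. by rewrite mxE. Qed.

Section Derivatives.
Context {R : realType} {V : normedModType R}.
Implicit Types (x v : V).

Lemma is_derive_mxP p q (F : V -> 'M[R]_(p, q)) (dF : 'M[R]_(p, q)) x v :
  (forall i j, is_derive x v (fun y => F y i j) (dF i j)) <-> is_derive x v F dF.
Proof.
split=> [dFij|[dFx eF] i j].
  have dFx : derivable F x v by apply/derivable_mxP => i j; case: (dFij i j).
  apply: DeriveDef => //; rewrite derive_mx //; apply/matrixP => i j.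
  by rewrite mxE; case: (dFij i j).
have /derivable_mxP dFij := dFx.
apply: DeriveDef; first exact: dFij.
by rewrite -eF derive_mx // mxE.
Qed.

Lemma is_derive_mulmx p q r (A : V -> 'M[R]_(p, q)) (B : V -> 'M[R]_(q, r))
    (dA : 'M[R]_(p, q)) (dB : 'M[R]_(q, r)) x v : is_derive x v A dA -> is_derive x v B dB ->
  is_derive x v (fun y => A y *m B y) (dA *m B x + A x *m dB).
Proof.
move=> /is_derive_mxP dAij /is_derive_mxP dBij; apply/is_derive_mxP => i j.
have -> : (fun y => (A y *m B y) i j) =
    \sum_k ((fun y => A y i k) * (fun y => B y k j)).
  by apply/funext => y; rewrite mxE fct_sumE.
apply: is_derive_eq; rewrite !mxE -big_split; apply: eq_bigr => k _ /=.
by rewrite addrC [_ *: dA _ _]mulrC.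
Qed.

Lemma near_is_derive (W : normedModType R) (f h : V -> W) df x v :
  {near x, f =1 h} -> is_derive x v f df -> is_derive x v h df.
Proof.
move=> fh [dfx <-]; apply: DeriveDef; first exact: near_eq_derivable fh dfx.
exact/esym/near_eq_derive.
Qed.

Lemma differentiable_expR_comp (f : V -> R) x :
  differentiable f x -> differentiable (fun y => expR (f y)) x.
Proof.
move=> df; apply: (@differentiable_comp _ _ _ _ f expR x df).
exact/derivable1_diffP/derivable_expR.
Qed.

Lemma is_derive_expR_comp (f : V -> R) x v : differentiable f x ->
  is_derive x v (fun y => expR (f y)) (expR (f x) * 'D_v f x).
Proof.
move=> df; apply: DeriveDef; first exact/diff_derivable/differentiable_expR_comp.
have de : differentiable (@expR R) (f x) by exact/derivable1_diffP/derivable_expR.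
rewrite (deriveE _ df) (deriveE _ (differentiable_expR_comp df)).
rewrite (diff_comp df de) /= (diff1E de) /=.
have -> : expR^`()%classic (f x) = expR (f x) by rewrite derive1E; exact: derive_val.
exact: mulrC.
Qed.

End Derivatives.

Lemma is_derive_trmx (R : realType) (V : normedModType R) p q
    (A : V -> 'M[R]_(p, q)) (dA : 'M[R]_(p, q)) (x v : V) :
  is_derive x v A dA -> is_derive x v (fun y => (A y)^T) dA^T.
Proof.
move=> /is_derive_mxP dAij; apply/is_derive_mxP => i j; rewrite mxE.
rewrite (_ : (fun y => (A y)^T i j) = (fun y => A y j i)); first exact: dAij.
by apply/funext => y; rewrite mxE.
Qed.

Lemma is_derive_scalemx (R : realType) (V : normedModType R) p q (f : V -> R)
    (A : V -> 'M[R]_(p, q)) (df : R) (dA : 'M[R]_(p, q)) (y v : V) :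
  is_derive y v f df -> is_derive y v A dA ->
  is_derive y v (fun z => f z *: A z) (df *: A y + f y *: dA).
Proof.
move=> dfy /is_derive_mxP dAij; apply/is_derive_mxP => i j.
rewrite (_ : (fun z => _) = f * (fun z => A z i j)); last first.
  by apply/funext => z; rewrite mxE.
by apply: is_derive_eq; rewrite !mxE addrC [_ *: df]mulrC.
Qed.

Lemma is_derive_row_mx (R : realType) (V : normedModType R) p q
    (A : V -> 'rV[R]_p) (B : V -> 'rV[R]_q) (dA : 'rV[R]_p) (dB : 'rV[R]_q)
    (x v : V) : is_derive x v A dA -> is_derive x v B dB ->
  is_derive x v (fun y => row_mx (A y) (B y)) (row_mx dA dB).
Proof.
move=> /is_derive_mxP dAij /is_derive_mxP dBij; apply/is_derive_mxP => i j.
under eq_fun do rewrite mxE.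
by rewrite mxE; case: (fintype.split j).
Qed.

Lemma is_derive_lsubmx (R : realType) p q (z v : 'rV[R]_(p + q)) :
  is_derive z v lsubmx (lsubmx v).
Proof.
apply/is_derive_mxP => i j; rewrite mxE; under eq_fun do rewrite mxE.
exact: (is_derive_mxP _ _ _ _).2 (is_derive_id z v) _ _.
Qed.

Lemma is_derive_rsubmx (R : realType) p q (z v : 'rV[R]_(p + q)) :
  is_derive z v rsubmx (rsubmx v).
Proof.
apply/is_derive_mxP => i j; rewrite mxE; under eq_fun do rewrite mxE.
exact: (is_derive_mxP _ _ _ _).2 (is_derive_id z v) _ _.
Qed.

(** The difference quotients vanish identically, which gives derivability along [v] together with
    the value. It is meant for the factor of the ambient metric that does not involve t. *)
Lemma is_derive_constant_line (R : realType) (V W : normedModType R) (f : V -> W)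
    (z v : V) : (forall h : R, f (h *: v + z) = f z) -> is_derive z v f 0.
Proof.
move=> fv; have E : (fun h : R => h^-1 *: ((f \o shift z) (h *: v) - f z)) = cst 0.
  by apply/funext => h; rewrite /= fv subrr scaler0.
by apply: DeriveDef; rewrite /derivable /derive E; [exact: is_cvg_cst|exact: lim_cst].
Qed.

(** * Closure properties of the classes C^k *)

Section SmoothCalculus.
Context {R : realType} {n : nat}.
Implicit Types (U : set 'rV[R]_n) (k : nat).

(** Used in the inductions on the class below: after a product rule the undifferentiated factor has
    class k+1, while the induction hypothesis asks for class k. *)
Lemma class_CW (W : normedModType R) k U (f : 'rV[R]_n -> W) :
  class_C k.+1 U f -> class_C k U f.
Proof.
elim: k f => [|k IH] f [df Df].
  by move=> y Uy; exact/differentiable_continuous/df.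
by split=> // v; apply: IH; exact: Df.
Qed.

Lemma class_CM k U (f h : 'rV[R]_n -> R) : open U ->
  class_C k U f -> class_C k U h -> class_C k U (fun y => f y * h y).
Proof.
move=> oU; elim: k f h => [|k IH] f h.
  by move=> cf ch y Uy; exact: continuousM (cf y Uy) (ch y Uy).
move=> Cf Ch; have [df Df] := Cf; have [dh Dh] := Ch; split=> [y Uy|v].
  exact: differentiableM (df y Uy) (dh y Uy).
apply: class_C_ext (class_CD oU (IH _ _ (class_CW Cf) (Dh v))
  (IH _ _ (class_CW Ch) (Df v))) => // y Uy /=.
by rewrite deriveM//; apply: diff_derivable; [exact: df|exact: dh].
Qed.

Lemma class_C_entry p q k U (F : 'rV[R]_n -> 'M[R]_(p, q)) i j :
  open U -> class_C k U F -> class_C k U (fun y => F y i j).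
Proof.
move=> oU; elim: k F => [|k IH] F /=.
  move=> cF y Uy.
  apply: (@continuous_comp _ _ _ F (fun w : 'M[R]_(p, q) => w i j)).
    exact: cF.
  exact: coord_continuous.
move=> [dF DF]; split=> [y Uy|v].
  apply: (@differentiable_comp _ _ _ _ F (fun w : 'M[R]_(p, q) => w i j)).
    exact: dF.
  exact: differentiable_coord.
apply: class_C_ext (IH _ (DF v)) => // y Uy.
by rewrite derive_mx ?mxE//; exact/diff_derivable/dF.
Qed.

Lemma class_C_scalel (W : normedModType R) k U (f : 'rV[R]_n -> R) (w : W) :
  open U -> class_C k U f -> class_C k U (fun y => f y *: w).
Proof.
move=> oU; elim: k f => [|k IH] f /=.
  move=> cf y Uy; apply: (@continuous_comp _ _ _ f (fun r => r *: w)).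
    exact: cf.
  exact: scalel_continuous.
move=> [df Df]; split=> [y Uy|v]; first exact/differentiableZl/df.
apply: class_C_ext (IH _ (Df v)) => // y Uy.
have dfy := df y Uy.
by rewrite (deriveE _ dfy) (deriveE _ (differentiableZl _ dfy)) (diffZl _ dfy).
Qed.

Lemma class_C_sum (W : normedModType R) (I : Type) (r : seq I) (P : pred I) k U
    (F : I -> 'rV[R]_n -> W) : open U -> (forall i, class_C k U (F i)) ->
  class_C k U (fun y => \sum_(i <- r | P i) F i y).
Proof.
move=> oU CF; elim: r => [|i r IH].
  by under eq_fun do rewrite big_nil; exact: class_C_cst.
under eq_fun do rewrite big_cons; case: (P i) => //.
exact: (class_CD oU (CF i) IH).
Qed.

Lemma class_C_prod (I : Type) (r : seq I) (P : pred I) k U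
    (F : I -> 'rV[R]_n -> R) : open U -> (forall i, class_C k U (F i)) ->
  class_C k U (fun y => \prod_(i <- r | P i) F i y).
Proof.
move=> oU CF; elim: r => [|i r IH].
  by under eq_fun do rewrite big_nil; exact: class_C_cst.
under eq_fun do rewrite big_cons; case: (P i) => //.
exact: (class_CM oU (CF i) IH).
Qed.

Lemma class_C_mx p q k U (F : 'rV[R]_n -> 'M[R]_(p, q)) : open U ->
  (forall i j, class_C k U (fun y => F y i j)) -> class_C k U F.
Proof.
move=> oU CF; apply: (@class_C_ext _ _ _ _ _
  (fun y => \sum_i \sum_j F y i j *: delta_mx i j)) => //.
  by move=> y _; rewrite -matrix_sum_delta.
by do 2![apply: class_C_sum => // ?]; exact: class_C_scalel.
Qed.

Lemma class_C_mulmx p q r k U (A : 'rV[R]_n -> 'M[R]_(p, q))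
    (B : 'rV[R]_n -> 'M[R]_(q, r)) : open U ->
  class_C k U A -> class_C k U B -> class_C k U (fun y => A y *m B y).
Proof.
move=> oU CA CB; apply: class_C_mx => // i j.
under eq_fun do rewrite mxE.
by apply: class_C_sum => // l; apply: class_CM => //; exact: class_C_entry.
Qed.

Lemma class_C_scale p q k U (f : 'rV[R]_n -> R) (A : 'rV[R]_n -> 'M[R]_(p, q)) :
  open U -> class_C k U f -> class_C k U A -> class_C k U (fun y => f y *: A y).
Proof.
move=> oU Cf CA; apply: class_C_mx => // i j.
by under eq_fun do rewrite mxE; apply: class_CM => //; exact: class_C_entry.
Qed.

Lemma class_C_det p k U (A : 'rV[R]_n -> 'M[R]_p) : open U ->
  class_C k U A -> class_C k U (fun y => \det (A y)).
Proof.
move=> oU CA; apply: class_C_sum => // s; apply: class_CM => //.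
  exact: class_C_cst.
by apply: class_C_prod => // i; exact: class_C_entry.
Qed.

(** The derivative - f^-2 D_v f involves only f^-1 itself and D_v f, so the induction on the class
    closes. *)
Lemma class_CV k U (f : 'rV[R]_n -> R) : open U -> (forall y, U y -> f y != 0) ->
  class_C k U f -> class_C k U (fun y => (f y)^-1).
Proof.
move=> oU f0; elim: k => [|k IH].
  by move=> cf y Uy; apply: continuousV; [exact: f0|exact: cf].
move=> Cf; have [df Df] := Cf; split=> [y Uy|v].
  by apply: differentiableV; [exact: df|exact: f0].
have CV := IH (class_CW Cf).
have CVDf := class_CM oU (class_CM oU CV CV) (Df v).
apply: class_C_ext (class_CM oU (class_C_cst _ _ (-1 : R)) CVDf) => // y Uy /=.
rewrite deriveV; [|exact: f0|exact/diff_derivable/df].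
by rewrite /cst mulN1r -invfM -expr2 scaleNr.
Qed.

(** Cramer's rule: the inverse is the adjugate divided by the determinant, and both are polynomial
    in the entries. *)
Lemma class_C_invmx p k U (A : 'rV[R]_n -> 'M[R]_p) : open U ->
  (forall y, U y -> A y \in unitmx) -> class_C k U A ->
  class_C k U (fun y => invmx (A y)).
Proof.
move=> oU uA CA; have detA y : U y -> \det (A y) != 0.
  by move=> /uA; rewrite unitmxE unitfE.
apply: (@class_C_ext _ _ _ _ _ (fun y => (\det (A y))^-1 *: \adj (A y))) => //.
  by move=> y Uy; rewrite /invmx uA.
apply: class_C_scale => //; first by apply: class_CV => //; exact: class_C_det.
apply: class_C_mx => // i j; under eq_fun do rewrite mxE /cofactor.
apply: class_CM => //; first exact: class_C_cst.
apply: class_C_det => //; apply: class_C_mx => // a b.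
by under eq_fun do rewrite !mxE; exact: class_C_entry.
Qed.

Lemma class_C_expR k U (f : 'rV[R]_n -> R) : open U ->
  class_C k U f -> class_C k U (fun y => expR (f y)).
Proof.
move=> oU; elim: k => [|k IH].
  move=> cf y Uy; apply: (@continuous_comp _ _ _ f expR); first exact: cf.
  exact: continuous_expR.
move=> Cf; have [df Df] := Cf; split=> [y Uy|v].
  exact: differentiable_expR_comp (df y Uy).
apply: class_C_ext (class_CM oU (IH (class_CW Cf)) (Df v)) => // y Uy /=.
by have [_ ->] := is_derive_expR_comp v (df y Uy).
Qed.

Lemma derive_comp m (W : normedModType R) (h : 'rV[R]_n -> 'rV[R]_m)
    (f : 'rV[R]_m -> W) y v : differentiable h y -> differentiable f (h y) ->
  'D_v (f \o h) y = 'D_('D_v h y) f (h y).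
Proof.
move=> dh df; rewrite (deriveE _ (differentiable_comp dh df)).
by rewrite (diff_comp dh df) (deriveE _ dh) (deriveE _ df).
Qed.

Lemma derive_rV m (W : normedModType R) (f : 'rV[R]_m -> W) y v :
  differentiable f y -> 'D_v f y = \sum_k v 0 k *: 'D_(delta_mx 0 k) f y.
Proof.
move=> df; rewrite (deriveE _ df) {1}[v]row_sum_delta linear_sum.
by apply: eq_bigr => k _; rewrite (deriveE _ df) linearZ.
Qed.

End SmoothCalculus.

Section SmoothComp.
Context {R : realType} {n m : nat}.

(** The chain rule differentiates [f] in the direction ['D_v h y], which varies with [y]. Expanding
    this direction in the standard basis leaves derivatives of [f] in fixed directions, to which the
    induction hypothesis applies. *)
Lemma class_C_comp_fun k (U : set 'rV[R]_n) (V : set 'rV[R]_m)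
    (h : 'rV[R]_n -> 'rV[R]_m) (f : 'rV[R]_m -> R) :
  open U -> open V -> (forall y, U y -> V (h y)) ->
  class_C k U h -> class_C k V f -> class_C k U (f \o h).
Proof.
move=> oU oV hUV; elim: k f => [|k IH] f.
  move=> ch cf y Uy; apply: continuous_comp; first exact: ch.
  exact: (cf _ (hUV y Uy)).
move=> Ch [df Df]; have [dh Dh] := Ch; split=> [y Uy|v].
  by apply: differentiable_comp; [exact: dh|exact/df/hUV].
pose F (l : 'I_m) y := 'D_v h y 0 l * ('D_(delta_mx 0 l) f \o h) y.
apply: (@class_C_ext _ _ _ _ _ (fun y => \sum_l F l y)) => //.
  move=> y Uy; have dfy := df _ (hUV _ Uy).
  by rewrite (derive_comp v (dh y Uy) dfy) (derive_rV _ dfy).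
apply: class_C_sum => // l; apply: class_CM => //; first exact: class_C_entry (Dh v).
exact: IH (class_CW Ch) (Df _).
Qed.

Lemma class_C_comp p q k (U : set 'rV[R]_n) (V : set 'rV[R]_m)
    (h : 'rV[R]_n -> 'rV[R]_m) (f : 'rV[R]_m -> 'M[R]_(p, q)) :
  open U -> open V -> (forall y, U y -> V (h y)) ->
  class_C k U h -> class_C k V f -> class_C k U (f \o h).
Proof.
move=> oU oV hUV Ch Cf; apply: class_C_mx => // i j.
apply: (@class_C_comp_fun k U V h (fun z => f z i j)) => //.
exact: class_C_entry.
Qed.

End SmoothComp.

(** * Symmetry of second derivatives *)

Section Schwarz.
Context {R : realType} {n : nat}.
Implicit Types (f : 'rV[R]_n -> R) (v w y : 'rV[R]_n).

Lemma is_derive_line f v y (s : R) : derivable f (s *: v + y) v ->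
  is_derive s 1 (fun r => f (r *: v + y)) ('D_v f (s *: v + y)).
Proof.
have E : (fun h : R => h^-1 *: (((fun r => f (r *: v + y)) \o shift s) (h *: 1) -
      f (s *: v + y))) =
    (fun h => h^-1 *: ((f \o shift (s *: v + y)) (h *: v) - f (s *: v + y))).
  by apply/funext => h /=; rewrite [h *: 1]mulr1 scalerDl addrA.
by move=> df; apply: DeriveDef; rewrite /derivable /derive E.
Qed.

(** The mean value theorem is applied twice: to the increment of [f] by h w along the segment in
    direction [v], then to ['D_v f] along the segment in direction [w]. The hypothesis keeps the
    whole parallelogram inside [U]. *)
Lemma second_difference_mean_value (U : set 'rV[R]_n) f v w y (h : R) : 0 < h ->
  class_C 2 U f ->
  (forall s t, 0 <= s <= h -> 0 <= t <= h -> U (s *: v + (t *: w + y))) ->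
  exists s t, [/\ 0 <= s <= h, 0 <= t <= h &
    f (h *: v + (h *: w + y)) - f (h *: v + y) - (f (h *: w + y) - f y) =
    h * h * 'D_w ('D_v f) (s *: v + (t *: w + y))].
Proof.
move=> h0 [df Df] hU.
have hh : 0 <= h <= h by rewrite lexx ltW.
have zz : 0 <= (0 : R) <= h by rewrite lexx ltW.
have hU0 s : 0 <= s <= h -> U (s *: v + y).
  by move=> sh; have := hU s 0 sh zz; rewrite scale0r add0r.
pose G s := f (s *: v + (h *: w + y)) - f (s *: v + y).
have dG s : 0 <= s <= h ->
    is_derive s 1 G ('D_v f (s *: v + (h *: w + y)) - 'D_v f (s *: v + y)).
  move=> sh; apply: is_deriveB.
    by apply: is_derive_line; apply/diff_derivable/df/hU.
  by apply: is_derive_line; apply/diff_derivable/df/hU0.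
have [s /andP[/ltW s0 /ltW sh] Gs] : exists2 s, s \in `]0, h[ &
    G h - G 0 = ('D_v f (s *: v + (h *: w + y)) - 'D_v f (s *: v + y)) * (h - 0).
  apply: (MVT h0) => [s|].
    by rewrite in_itv /= => /andP[/ltW s0 /ltW sh]; apply: dG; rewrite s0.
  by apply: derivable_within_continuous => s; rewrite in_itv => /dG[].
have {}sh : 0 <= s <= h by rewrite s0.
pose H t := 'D_v f (t *: w + (s *: v + y)).
have dH t : 0 <= t <= h ->
    is_derive t 1 H ('D_w ('D_v f) (t *: w + (s *: v + y))).
  move=> th; apply: is_derive_line; apply/diff_derivable/(Df v).1.
  by rewrite addrCA; exact: hU.
have [t /andP[/ltW t0 /ltW th] Ht] : exists2 t, t \in `]0, h[ &
    H h - H 0 = 'D_w ('D_v f) (t *: w + (s *: v + y)) * (h - 0).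
  apply: (MVT h0) => [t|].
    by rewrite in_itv /= => /andP[/ltW t0 /ltW th]; apply: dH; rewrite t0.
  by apply: derivable_within_continuous => t; rewrite in_itv => /dH[].
exists s, t; split=> //; first by rewrite t0.
move: Gs Ht; rewrite /G /H !scale0r !add0r subr0 => ->.
by rewrite addrCA => ->; rewrite addrCA; ring.
Qed.

(** The second difference over a small parallelogram is symmetric in [v] and [w], and it equals h^2
    times either mixed derivative at some point of it. If the mixed derivatives at [y] differed by e
    > 0, continuity would keep each within e/2 of its value at [y] there, giving e < e. *)
Lemma derive_comm (U : set 'rV[R]_n) f v w y : open U -> U y ->
  class_C 2 U f -> 'D_v ('D_w f) y = 'D_w ('D_v f) y.
Proof.
move=> oU Uy Cf; apply: contrapT => /eqP; rewrite -subr_eq0 -normr_gt0.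
set e := `| _ | => e0.
have [_ Df] := Cf.
have cvw := ((Df w).2 v) y Uy; have cwv := ((Df v).2 w) y Uy.
have e2 : 0 < e / 2 by rewrite divr_gt0.
have nU : \forall p \near y, U p by exact: open_nbhs_nbhs.
have /cvgrPdist_lt /(_ _ e2) n1 := cvw; have /cvgrPdist_lt /(_ _ e2) n2 := cwv.
have [r /= r0 near_y] := (nbhs_ballP _ _).1 (filterI nU (filterI n1 n2)).
(* The parallelogram of size h has reach at most h (|v| + |w|); the added 1 makes this strictly less
   than r and keeps the denominator positive when [v] and [w] vanish. *)
pose h := r / (`|v| + `|w| + 1).
have k0 : 0 < `|v| + `|w| + 1 by rewrite ltr_wpDl// addr_ge0.
have h0 : 0 < h by rewrite divr_gt0.
have small s t : 0 <= s <= h -> 0 <= t <= h -> ball y r (s *: v + (t *: w + y)).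
  move=> /andP[s0 sh] /andP[t0 th].
  rewrite -ball_normE /= distrC addrA addrK.
  apply: (le_lt_trans (ler_normD _ _)); rewrite !normrZ !ger0_norm//.
  apply: (@le_lt_trans _ _ (h * (`|v| + `|w|))).
    by rewrite mulrDr lerD// ler_wpM2r.
  by rewrite /h mulrAC ltr_pdivrMr// ltr_pM2l// ltrDl.
have [p1 [_ [_ N1]] E1] : exists2 p, (U p /\
      `|'D_v ('D_w f) y - 'D_v ('D_w f) p| < e / 2 /\
      `|'D_w ('D_v f) y - 'D_w ('D_v f) p| < e / 2) &
    f (h *: v + (h *: w + y)) - f (h *: v + y) - (f (h *: w + y) - f y) =
    h * h * 'D_w ('D_v f) p.
  have [|s [t [sh th E]]] := @second_difference_mean_value U f v w y h h0 Cf.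
    by move=> s t sh th; case: (near_y _ (small s t sh th)).
  by exists (s *: v + (t *: w + y)); [exact: near_y (small _ _ sh th)|].
have [p2 [_ [N2 _]] E2] : exists2 p, (U p /\
      `|'D_v ('D_w f) y - 'D_v ('D_w f) p| < e / 2 /\
      `|'D_w ('D_v f) y - 'D_w ('D_v f) p| < e / 2) &
    f (h *: w + (h *: v + y)) - f (h *: w + y) - (f (h *: v + y) - f y) =
    h * h * 'D_v ('D_w f) p.
  have [|t [s [th sh E]]] := @second_difference_mean_value U f w v y h h0 Cf.
    move=> t s th sh; rewrite addrCA.
    by case: (near_y _ (small s t sh th)).
  exists (t *: w + (s *: v + y)); last exact: E.
  by rewrite addrCA; exact: near_y (small _ _ sh th).
have fE : f (h *: v + (h *: w + y)) - f (h *: v + y) - (f (h *: w + y) - f y) =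
    f (h *: w + (h *: v + y)) - f (h *: w + y) - (f (h *: v + y) - f y).
  rewrite [h *: w + (h *: v + y)]addrCA.
  by move: (f _) (f _) (f _) (f _) => a b c d; rewrite !opprB; ring.
have E : 'D_w ('D_v f) p1 = 'D_v ('D_w f) p2.
  apply: (mulfI (mulf_neq0 (lt0r_neq0 h0) (lt0r_neq0 h0))).
  exact: etrans (esym E1) (etrans fE E2).
have {}N1 : `|'D_v ('D_w f) p2 - 'D_w ('D_v f) y| < e / 2.
  by rewrite distrC; exact: (eq_ind _ (fun r => `|_ - r| < e / 2) N1 _ E).
suff : e < e by rewrite ltxx.
rewrite [ltRHS]splitr; apply: le_lt_trans (ltrD N2 N1).
exact: ler_distD.
Qed.

End Schwarz.

Local Opaque derive jacobian.

(** * Charts and vector fields *)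

Section Charts.
Context {R : realType} {n : nat} (M : manifold R n).
Implicit Types (i j k : chart M) (p q : M) (v w : 'rV[R]_n).

Local Notation transition i j := (chart_map M j \o chart_inv M i).

Lemma open_coord_img i (U : set M) : open U -> open (coord_img i U).
Proof. exact: coord_img_open. Qed.

Lemma near_coord_img i p (U : set M) : chart_dom M i p -> nbhs p U ->
  \forall y \near chart_map M i p, coord_img i U y.
Proof.
move=> ip; rewrite nbhsE /= => -[V oV VU].
have: nbhs (chart_map M i p) (coord_img i V).
  apply: open_nbhs_nbhs; split; first exact/open_coord_img/oV.1.
  by exists p => //; split => //; exact: oV.2.
by apply: filterS => _ [q [iq Vq] <-]; exists q => //; split => //; exact: VU.
Qed.

(** [chart_inv] is controlled only on the image of the chart. Since charts are homeomorphisms onto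
    open sets, a property of points near [p] passes to all coordinates near the image of [p]. *)
Lemma near_chart i p (P : set 'rV[R]_n) : chart_dom M i p ->
  (\forall q \near p, chart_dom M i q -> P (chart_map M i q)) ->
  \forall y \near chart_map M i p, P y.
Proof.
move=> ip nP; apply: filterS (near_coord_img ip nP) => _ [q [iq Pq] <-].
exact: Pq.
Qed.

Lemma near_chartW i p (P : set 'rV[R]_n) : chart_dom M i p ->
  (forall q, chart_dom M i q -> P (chart_map M i q)) ->
  \forall y \near chart_map M i p, P y.
Proof. by move=> ip iP; apply: near_chart => //; exact: nearW. Qed.

Lemma near_dom i p : chart_dom M i p -> \forall q \near p, chart_dom M i q.
Proof. by move=> ip; apply: open_nbhs_nbhs; split=> //; exact: chart_dom_open. Qed.

Lemma transition_differentiable i j p : chart_dom M i p -> chart_dom M j p ->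
  differentiable (transition i j) (chart_map M i p).
Proof.
by move=> ip jp; apply: (@transition_smooth _ _ M i j 1%N).1; exists p.
Qed.

Lemma mul_chart_change i j p v : chart_dom M i p -> chart_dom M j p ->
  v *m chart_change i j p = 'D_v (transition i j) (chart_map M i p).
Proof.
by move=> ip jp; rewrite deriveEjacobian//; exact: transition_differentiable.
Qed.

Local Opaque chart_change.

Section ChangeOfChart.
Context {W : normedModType R} (F : M -> W) {i j : chart M} {p : M}.
Hypotheses (ip : chart_dom M i p) (jp : chart_dom M j p).
Hypothesis dF : differentiable (F \o chart_inv M j) (chart_map M j p).

Let nearF : {near chart_map M i p,
  (F \o chart_inv M j) \o transition i j =1 F \o chart_inv M i}.
Proof.
apply: near_chart => //; apply: filterS (near_dom jp) => q jq iq /=.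
by rewrite !chart_mapK.
Qed.

(** [F] takes values in any normed space: for real values this makes [dir_derive] computable in
    every chart, and for [F] a chart map it is the cocycle rule [chart_change_trans]. *)
Lemma derive_chart v : 'D_v (F \o chart_inv M i) (chart_map M i p) =
  'D_(v *m chart_change i j p) (F \o chart_inv M j) (chart_map M j p).
Proof.
rewrite -(near_eq_derive _ nearF).
rewrite (derive_comp _ (transition_differentiable ip jp)).
  by rewrite (mul_chart_change _ ip jp) /= chart_mapK.
by rewrite /= chart_mapK.
Qed.

End ChangeOfChart.

Lemma chart_change_trans i j k p :
  chart_dom M i p -> chart_dom M j p -> chart_dom M k p ->
  chart_change i j p *m chart_change j k p = chart_change i k p.
Proof.
move=> ip jp kp; apply/row_matrixP => a; rewrite !rowE mulmxA.
apply: etrans (mul_chart_change _ jp kp) _.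
apply: etrans (esym (mul_chart_change _ ip kp)).
exact/esym/(derive_chart ip jp)/transition_differentiable.
Qed.

Lemma chart_change_id i p : chart_dom M i p -> chart_change i i p = 1%:M.
Proof.
move=> ip; apply/row_matrixP => a; rewrite !rowE (mul_chart_change _ ip ip).
have nid : {near chart_map M i p, transition i i =1 id}.
  by apply: near_chartW => // q iq /=; rewrite chart_mapK.
by rewrite (near_eq_derive _ nid) derive_id mulmx1.
Qed.

Lemma chart_changeK i j p : chart_dom M i p -> chart_dom M j p ->
  chart_change i j p *m chart_change j i p = 1%:M.
Proof. by move=> ip jp; rewrite chart_change_trans// chart_change_id. Qed.

Lemma chart_change_unit i j p : chart_dom M i p -> chart_dom M j p ->
  chart_change i j p \in unitmx.
Proof. by move=> ip jp; exact: (mulmx1_unit (chart_changeK ip jp)).1. Qed.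

Lemma vcomp_at p (X : vfield M) : vcomp (chart_at M p) X p = X p.
Proof. by rewrite /vcomp chart_change_id ?mulmx1//; exact: chart_at_dom. Qed.

Lemma dir_derive_chart i p (f : M -> R) v : chart_dom M i p ->
  differentiable (f \o chart_inv M i) (chart_map M i p) ->
  dir_derive f p v =
  'D_(v *m chart_change (chart_at M p) i p) (f \o chart_inv M i) (chart_map M i p).
Proof. by move=> ip df; rewrite /dir_derive (derive_chart _ ip df)//; exact: chart_at_dom. Qed.

Lemma mul_dfun (f : M -> R) p v :
  differentiable (f \o chart_inv M (chart_at M p)) (chart_map M (chart_at M p) p) ->
  v *m dfun f p = (dir_derive f p v)%:M.
Proof.
move=> df; apply/matrixP => a b; rewrite !ord1 !mxE eqxx mulr1n.
rewrite /dir_derive (derive_rV _ df); apply: eq_bigr => k _.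
by rewrite mxE.
Qed.

Lemma smooth_fun_differentiable (U : set M) i p (f : M -> R) : chart_dom M i p -> U p ->
  smooth_fun U f -> differentiable (f \o chart_inv M i) (chart_map M i p).
Proof. by move=> ip Up sf; apply: (sf i 1%N).1; exists p. Qed.

Lemma smooth_vfield_differentiable (U : set M) i p (X : vfield M) :
  chart_dom M i p -> U p -> smooth_vfield U X ->
  differentiable (vcomp i X \o chart_inv M i) (chart_map M i p).
Proof. by move=> ip Up sX; apply: (sX i 1%N).1; exists p. Qed.

(* [coord_vfield i k] is convertible to [const_field i (delta_mx 0 k)]. *)
Definition const_field i v : vfield M := fun q =>
  v *m chart_change i (chart_at M q) q.

Lemma const_field_at p v : const_field (chart_at M p) v p = v.
Proof. by rewrite /const_field chart_change_id ?mulmx1//; exact: chart_at_dom. Qed.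

Lemma vcomp_const_field i j v q : chart_dom M i q -> chart_dom M j q ->
  vcomp j (const_field i v) q = v *m chart_change i j q.
Proof.
by move=> iq jq; rewrite /vcomp -mulmxA chart_change_trans//; exact: chart_at_dom.
Qed.

(** In another chart the components are a directional derivative of the transition map, read back
    through the inverse transition; class k of the field costs class k+1 of the transition. *)
Lemma const_field_smooth i v : smooth_vfield (chart_dom M i) (const_field i v).
Proof.
move=> j k.
have oj := @open_coord_img j _ (chart_dom_open i).
have oi := @open_coord_img i _ (chart_dom_open j).
apply: (@class_C_ext _ _ _ _ _ ('D_v (transition i j) \o transition j i)) => //.
  move=> _ [q [jq iq] <-] /=.
  by rewrite chart_mapK// vcomp_const_field// mul_chart_change.
apply: (class_C_comp oj oi).
- by move=> _ [q [jq iq] <-]; exists q => //=; rewrite chart_mapK.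
- exact: transition_smooth.
- exact: (@transition_smooth _ _ M i j k.+1).2.
Qed.

Lemma const_field_smooth_near i v p :
  chart_dom M i p -> smooth_near_vfield p (const_field i v).
Proof.
move=> ip; exists (chart_dom M i); last exact: const_field_smooth.
by split=> //; exact: chart_dom_open.
Qed.

(** Both component functions are constant in the chart at [p]. This removes the bracket terms from
    the Koszul formula. *)
Lemma lie_bracket_const_field p v w :
  lie_bracket (const_field (chart_at M p) v) (const_field (chart_at M p) w) p = 0.
Proof.
have pp : chart_dom M (chart_at M p) p by exact: chart_at_dom.
suff D0 a b : 'D_a (vcomp (chart_at M p) (const_field (chart_at M p) b) \o
    chart_inv M (chart_at M p)) (chart_map M (chart_at M p) p) = 0.
  by rewrite /lie_bracket !D0 subrr.
have ncst : {near chart_map M (chart_at M p) p,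
    vcomp (chart_at M p) (const_field (chart_at M p) b) \o
    chart_inv M (chart_at M p) =1 cst b}.
  apply: near_chartW => // q iq /=.
  by rewrite chart_mapK// vcomp_const_field// chart_change_id// mulmx1.
by rewrite (near_eq_derive _ ncst) derive_cst.
Qed.

End Charts.

(** * The gradient and its smoothness *)

Section Gradient.
Context {R : realType} {n : nat} (M : manifold R n) (g : tensor02 M).
Hypothesis g_riem : riemannian g.
Implicit Types (p q : M) (v w : 'rV[R]_n) (u : M -> R).

Lemma riemannian_sym p : (g p)^T = g p.
Proof. by have [_ -> _] := g_riem. Qed.

Lemma riemannian_unit p : g p \in unitmx.
Proof.
have [_ _ pos] := g_riem; rewrite -row_free_unit -kermx_eq0.
apply/negPn/negP => /rowV0Pn[v /sub_kermxP vg v0].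
by have := pos p v v0; rewrite /bform vg mul0mx mxE ltxx.
Qed.

Lemma gradientP u p v : smooth_fun setT u ->
  bform (g p) (gradient g u p) v = dir_derive u p v.
Proof.
move=> su; have pp := chart_at_dom p.
rewrite /bform /gradient mulmxKV ?riemannian_unit// -trmx_mul mul_dfun.
  by rewrite !mxE eqxx mulr1n.
exact: smooth_fun_differentiable su.
Qed.

Lemma comp02_unit i p : chart_dom M i p -> comp02 i g p \in unitmx.
Proof.
move=> ip; have pp := chart_at_dom p.
by rewrite !unitmx_mul unitmx_tr !chart_change_unit ?riemannian_unit.
Qed.

(** [gradient] is computed at each point in the chart [chart_at p]. Smoothness needs its expression
    in one fixed chart, which is du times the inverse metric matrix there. *)
Lemma vcomp_gradient u i p : smooth_fun setT u -> chart_dom M i p ->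
  vcomp i (gradient g u) p =
  (\row_k 'D_(delta_mx 0 k) (u \o chart_inv M i) (chart_map M i p)) *m
  invmx (comp02 i g p).
Proof.
move=> su ip; have pp := chart_at_dom p.
have -> : (\row_k 'D_(delta_mx 0 k) (u \o chart_inv M i) (chart_map M i p)) =
    (chart_change i (chart_at M p) p *m dfun u p)^T.
  have du := smooth_fun_differentiable pp I su.
  apply/rowP => k; rewrite !mxE (derive_chart ip pp du) (derive_rV _ du).
  by apply: eq_bigr => l _; rewrite -rowE !mxE.
apply: (canRL (mulmxK (comp02_unit ip))); rewrite /vcomp /gradient /comp02.
have := chart_changeK pp ip.
move: (chart_change _ i p) (chart_change i _ p) => A B AB.
rewrite !mulmxA -(mulmxA _ A B) AB mulmx1 mulmxKV ?riemannian_unit//.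
by rewrite trmx_mul.
Qed.

Lemma gradient_smooth u : smooth_fun setT u -> smooth_vfield setT (gradient g u).
Proof.
have [sg _ _] := g_riem; move=> su i k.
have oT : open (coord_img i (@setT M)) by apply: open_coord_img; exact: openT.
apply: (@class_C_ext _ _ _ _ _ (fun y =>
  (\row_k 'D_(delta_mx 0 k) (u \o chart_inv M i) y) *m
  invmx ((comp02 i g \o chart_inv M i) y))) => //.
  by move=> _ [p [ip _] <-] /=; rewrite chart_mapK// vcomp_gradient.
apply: class_C_mulmx => //.
  apply: class_C_mx => // a b; under eq_fun do rewrite mxE.
  exact: (su i k.+1).2.
apply: class_C_invmx => //; last exact: sg.
by move=> _ [p [ip _] <-] /=; rewrite chart_mapK// comp02_unit.
Qed.

End Gradient.

Local Opaque chart_change.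

(** * The pullback connection *)

Section BilinearForms.
Context {R : realType} {n : nat}.
Implicit Types (B A : 'M[R]_n) (u v w : 'rV[R]_n).

Lemma bformDl B u v w : bform B (u + v) w = bform B u w + bform B v w.
Proof. by rewrite /bform !mulmxDl mxE. Qed.
Lemma bformNl B v w : bform B (- v) w = - bform B v w.
Proof. by rewrite /bform !mulNmx mxE. Qed.
Lemma bformZl B (a : R) v w : bform B (a *: v) w = a * bform B v w.
Proof. by rewrite /bform -!scalemxAl mxE. Qed.
Lemma bformZr B (a : R) v w : bform B v (a *: w) = a * bform B v w.
Proof. by rewrite /bform linearZ /= -scalemxAr mxE. Qed.
Lemma bform0l B w : bform B 0 w = 0.
Proof. by rewrite /bform !mul0mx mxE. Qed.

Lemma bform0r B v : bform B v 0 = 0.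
Proof. by rewrite /bform trmx0 mulmx0 mxE. Qed.

Lemma bform_sym B v w :
  B^T = B -> bform B v w = bform B w v.
Proof.
move=> symB; transitivity ((v *m B *m w^T)^T 0 0); first by rewrite mxE.
by rewrite !trmx_mul trmxK symB mulmxA.
Qed.

Lemma bform_delta B k l : bform B (delta_mx 0 k) (delta_mx 0 l) = B k l.
Proof. by rewrite /bform -rowE trmx_delta -colE !mxE. Qed.

Lemma bform_mul B A v w : bform B (v *m A) (w *m A) = bform (A *m B *m A^T) v w.
Proof. by rewrite /bform trmx_mul !mulmxA. Qed.

Lemma bform_rowl B A k l : bform B (row k A) (delta_mx 0 l) = (A *m B) k l.
Proof. by rewrite -bform_delta /bform !rowE !mulmxA. Qed.

Lemma bform_rowr B A k l : bform B (delta_mx 0 k) (row l A) = (B *m A^T) k l.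
Proof. by rewrite -bform_delta /bform !rowE trmx_mul !mulmxA. Qed.

End BilinearForms.

Definition differentiable_fun_at {R : realType} {n : nat} (M : manifold R n)
    (f : M -> R) (x : M) :=
  differentiable (f \o chart_inv M (chart_at M x)) (chart_map M (chart_at M x) x).

Section CoordinateFrame.
Context {R : realType} {m : nat} (N : manifold R m) (g : tensor02 N).
Context (D : connection N) (compat : metric_compatible g D).

(** The connection 1-form of the coordinate frame around [p], evaluated at [w]. A row of components
    is multiplied by it on the right. *)
Definition connection_matrix (p : N) (w : 'rV[R]_m) : 'M[R]_m :=
  \matrix_k D p w (coord_vfield (chart_at N p) k).

(** Metric compatibility tested on pairs of coordinate fields, whose pairings are the entries of the
    metric matrix: dG = omega G + G omega^T. *)
Lemma derive_metric_matrix p w :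
  differentiable (comp02 (chart_at N p) g \o chart_inv N (chart_at N p))
    (chart_map N (chart_at N p) p) ->
  'D_w (comp02 (chart_at N p) g \o chart_inv N (chart_at N p))
    (chart_map N (chart_at N p) p) =
  connection_matrix p w *m g p + g p *m (connection_matrix p w)^T.
Proof.
set j := chart_at N p => dG; have pj : chart_dom N j p by exact: chart_at_dom.
apply/matrixP => k l; rewrite derive_mx; last exact: diff_derivable.
rewrite [LHS]mxE [RHS]mxE -bform_rowl -bform_rowr !rowK.
have := compat w (const_field_smooth_near (delta_mx 0 k) pj)
  (const_field_smooth_near (delta_mx 0 l) pj).
rewrite !const_field_at; apply: etrans.
apply: near_eq_derive; apply: near_chartW => // q jq /=.
by rewrite chart_mapK// bform_mul bform_delta.
Qed.

End CoordinateFrame.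

Section PullbackConnection.
Context {R : realType} {n m : nat} (M : manifold R n) (N : manifold R m).
Context (g : tensor02 N) (D : connection N) (Psi : M -> N).
Implicit Types (Z W : M -> 'rV[R]_m) (f : M -> R) (x : M) (v : 'rV[R]_n).

Definition differentiable_along_at Z x :=
  differentiable (acomp Psi (chart_at N (Psi x)) Z \o chart_inv M (chart_at M x))
    (chart_map M (chart_at M x) x).

Lemma acomp_at Z x : acomp Psi (chart_at N (Psi x)) Z x = Z x.
Proof. by rewrite /acomp chart_change_id ?mulmx1//; exact: chart_at_dom. Qed.

Lemma pullback_connectionE x v Z : pullback_connection D Psi x v Z =
  'D_v (acomp Psi (chart_at N (Psi x)) Z \o chart_inv M (chart_at M x))
    (chart_map M (chart_at M x) x) +
  Z x *m connection_matrix D (Psi x) (v *m differential Psi x).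
Proof.
rewrite /pullback_connection [X in _ = _ + X]mulmx_sum_row; congr (_ + _).
by apply: eq_bigr => k _; rewrite rowK.
Qed.

Lemma pullback_connectionD x v Z W :
  differentiable_along_at Z x -> differentiable_along_at W x ->
  pullback_connection D Psi x v (fun q => Z q + W q) =
  pullback_connection D Psi x v Z + pullback_connection D Psi x v W.
Proof.
move=> dZ dW; rewrite !pullback_connectionE mulmxDl addrACA; congr (_ + _).
have -> : acomp Psi (chart_at N (Psi x)) (fun q => Z q + W q) \o
    chart_inv M (chart_at M x) =
  (acomp Psi (chart_at N (Psi x)) Z \o chart_inv M (chart_at M x)) +
  (acomp Psi (chart_at N (Psi x)) W \o chart_inv M (chart_at M x)).
  by apply/funext => y; rewrite /= /acomp mulmxDl.
exact: deriveD (diff_derivable dZ) (diff_derivable dW).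
Qed.

Lemma pullback_connection_leibniz x v f Z :
  differentiable_fun_at f x -> differentiable_along_at Z x ->
  pullback_connection D Psi x v (fun q => f q *: Z q) =
  dir_derive f x v *: Z x + f x *: pullback_connection D Psi x v Z.
Proof.
move=> df dZ; rewrite !pullback_connectionE -scalemxAl scalerDr addrA.
congr (_ + _).
set Zc := acomp Psi (chart_at N (Psi x)) Z \o chart_inv M (chart_at M x).
pose fc := f \o chart_inv M (chart_at M x).
have -> : acomp Psi (chart_at N (Psi x)) (fun q => f q *: Z q) \o
    chart_inv M (chart_at M x) = (fun y => fc y *: Zc y).
  by apply/funext => y; rewrite /= /acomp -scalemxAl.
have dfc : is_derive (chart_map M (chart_at M x) x) v fc (dir_derive f x v).
  exact/derivableP/diff_derivable/df.
have dZc : is_derive (chart_map M (chart_at M x) x) v Zc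
    ('D_v Zc (chart_map M (chart_at M x) x)).
  exact/derivableP/diff_derivable/dZ.
have [_ E] := is_derive_scalemx dfc dZc; apply: etrans E _.
by rewrite /fc /Zc /= chart_mapK ?acomp_at//; exact: chart_at_dom.
Qed.

Lemma bform_acomp j Z W x : chart_dom N j (Psi x) ->
  bform (comp02 j g (Psi x)) (acomp Psi j Z x) (acomp Psi j W x) =
  bform (g (Psi x)) (Z x) (W x).
Proof.
move=> jx; have := chart_changeK (chart_at_dom (Psi x)) jx.
rewrite /bform /comp02 /acomp.
move: (chart_change _ j _) (chart_change j _ _) => A B AB.
rewrite !trmx_mul !mulmxA -(mulmxA (Z x)) AB mulmx1.
by rewrite -(mulmxA _ B^T) -trmx_mul AB trmx1 mulmx1.
Qed.

(** [pullback_connection] applies [D] to coordinate fields only, while [Z] and [W] live on [M], so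
    this is no instance of the compatibility of [D]. In fixed charts the pairing is the matrix
    product Z G(Psi) W^T. The chain rule and [derive_metric_matrix] differentiate the middle factor,
    and its two terms are the connection terms of [Z] and [W]. *)
Lemma pullback_connection_metric x v Z W : metric_compatible g D ->
  (\forall q \near x, chart_dom N (chart_at N (Psi x)) (Psi q)) ->
  differentiable (comp02 (chart_at N (Psi x)) g \o chart_inv N (chart_at N (Psi x)))
    (chart_map N (chart_at N (Psi x)) (Psi x)) ->
  differentiable (chart_map N (chart_at N (Psi x)) \o Psi \o chart_inv M (chart_at M x))
    (chart_map M (chart_at M x) x) ->
  differentiable_along_at Z x -> differentiable_along_at W x ->
  dir_derive (fun q => bform (g (Psi q)) (Z q) (W q)) x v =
  bform (g (Psi x)) (pullback_connection D Psi x v Z) (W x) +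
  bform (g (Psi x)) (Z x) (pullback_connection D Psi x v W).
Proof.
move=> compat nj dg dPsi dZ dW.
rewrite !pullback_connectionE; set i := chart_at M x.
have ix : chart_dom M i x by exact: chart_at_dom.
have jx : chart_dom N (chart_at N (Psi x)) (Psi x) by exact: chart_at_dom.
set j := chart_at N (Psi x) in dg dPsi *; set y := chart_map M i x in dPsi *.
set Phi := (X in differentiable X y) in dPsi.
have Phiy : Phi y = chart_map N j (Psi x) by rewrite /Phi /= chart_mapK.
pose Zc := acomp Psi j Z \o chart_inv M i.
pose Wc := acomp Psi j W \o chart_inv M i.
have Zy : Zc y = Z x by rewrite /Zc /= chart_mapK ?acomp_at.
have Wy : Wc y = W x by rewrite /Wc /= chart_mapK ?acomp_at.
pose Gc := comp02 j g \o chart_inv N j.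
pose L := connection_matrix D (Psi x) (v *m differential Psi x).
have dGPhi : is_derive y v (Gc \o Phi) (L *m g (Psi x) + g (Psi x) *m L^T).
  have dg' : differentiable Gc (Phi y) by rewrite Phiy.
  apply: DeriveDef; first exact/diff_derivable/differentiable_comp.
  apply: etrans (derive_metric_matrix compat _ dg).
  apply: etrans (derive_comp _ dPsi dg') _.
  by rewrite (deriveEjacobian _ dPsi) Phiy.
have dZy : is_derive y v Zc ('D_v Zc y) by apply/derivableP/diff_derivable/dZ.
have dWy : is_derive y v Wc ('D_v Wc y) by apply/derivableP/diff_derivable/dW.
have /is_derive_mxP/(_ 0 0) [_] :=
  is_derive_mulmx (is_derive_mulmx dZy dGPhi) (is_derive_trmx dWy).
have -> : (Gc \o Phi) y = g (Psi x).
  rewrite /= Phiy /Gc /= chart_mapK// /comp02 chart_change_id//.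
  by rewrite mul1mx trmx1 mulmx1.
rewrite Zy Wy => E; apply: etrans (etrans _ E) _.
  (* By [nj] the points near x are sent into the single chart at [Psi x], where [bform_acomp]
     identifies the pairing with the matrix product. *)
  apply: near_eq_derive; apply: near_chart => //.
  apply: filterS nj => q jq iq /=.
  by rewrite /Zc /Wc /Phi /Gc /= !chart_mapK// -(@bform_acomp j).
rewrite /bform -/Zc -/Wc -/L; move: ('D_v Zc y) ('D_v Wc y) => dZv dWv.
rewrite [(dWv + _)^T]raddfD /= trmx_mul !mulmxDl !mulmxDr !mulmxDl !mulmxA.
by rewrite !addmx00 !addrA; exact: addrAC.
Qed.

End PullbackConnection.

(** * The bracket as a commutator of derivations *)

Section LieBracket.
Context {R : realType} {n : nat} (M : manifold R n).
Implicit Types (f : M -> R) (X V W : vfield M).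

Lemma dir_derive_smooth f X : smooth_fun setT f -> smooth_vfield setT X ->
  smooth_fun setT (fun q => dir_derive f q (X q)).
Proof.
move=> sf sX i k.
have oT : open (coord_img i (@setT M)) by apply: open_coord_img; exact: openT.
apply: (@class_C_ext _ _ _ _ _ (fun y => \sum_l
  (vcomp i X \o chart_inv M i) y 0 l * 'D_(delta_mx 0 l) (f \o chart_inv M i) y)) => //.
  move=> _ [q [iq _] <-].
  have df := smooth_fun_differentiable iq I sf.
  rewrite /= chart_mapK// (dir_derive_chart _ iq df).
  exact/esym/(derive_rV (vcomp i X q) df).
apply: class_C_sum => // l; apply: class_CM => //.
  exact: class_C_entry (sX i k).
exact: (sf i k.+1).2.
Qed.

(** Product rule for the sum of X^k d_k f. Exchanging the two derivatives of [f] lets the components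
    of [X], frozen at [x], recombine into one direction [X x]. *)
Lemma derive_dir_derive f X (x : M) (v : 'rV[R]_n) :
  smooth_fun setT f -> smooth_vfield setT X ->
  let i := chart_at M x in let y := chart_map M i x in
  dir_derive (fun q => dir_derive f q (X q)) x v =
  'D_('D_v (vcomp i X \o chart_inv M i) y) (f \o chart_inv M i) y +
  'D_(X x) ('D_v (f \o chart_inv M i)) y.
Proof.
move=> sf sX i y.
have ix : chart_dom M i x by exact: chart_at_dom.
have oT : open (coord_img i (@setT M)) by apply: open_coord_img; exact: openT.
have Ty : coord_img i setT y by exists x.
set fc := f \o _; set Xc := vcomp i X \o _.
have Xy : Xc y = X x by rewrite /Xc /= chart_mapK// vcomp_at.
have dXc : is_derive y v Xc ('D_v Xc y).
  exact/derivableP/diff_derivable/(smooth_vfield_differentiable ix I sX).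
pose Fc z := (Xc z *m \col_k 'D_(delta_mx 0 k) fc z) 0 0.
have near_Fc : {near y, Fc =1 (fun q => dir_derive f q (X q)) \o chart_inv M i}.
  apply: near_chartW => // q iq.
  have df := smooth_fun_differentiable iq I sf.
  rewrite /Fc /Xc /= chart_mapK// (dir_derive_chart _ iq df).
  rewrite (derive_rV (vcomp i X q) df) mxE.
  by apply: eq_bigr => k _; rewrite [X in _ * X]mxE.
have dDf : is_derive y v (fun z => \col_k 'D_(delta_mx 0 k) fc z)
    (\col_k 'D_v ('D_(delta_mx 0 k) fc) y : 'M[R]_(n, 1)).
  apply/is_derive_mxP => k b; rewrite mxE.
  under eq_fun do rewrite mxE.
  by apply/derivableP/diff_derivable; exact: ((sf i 2%N).2 _).1.
have /is_derive_mxP/(_ 0 0) [_ E] := is_derive_mulmx dXc dDf.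
rewrite /dir_derive -(near_eq_derive _ near_Fc); apply: etrans E _.
rewrite addmx00 Xy; congr (_ + _).
  rewrite (derive_rV _ (smooth_fun_differentiable ix I sf)) mxE.
  by apply: eq_bigr => k _; rewrite [X in _ * X]mxE.
rewrite (derive_rV _ (((sf i 2%N).2 v).1 y Ty)) mxE.
apply: eq_bigr => k _.
rewrite [X in _ * X]mxE.
have C := derive_comm v (delta_mx 0 k) oT Ty (sf i 2%N).
exact: (congr1 (fun r : R => X x 0 k * r) C).
Qed.

(** Each iterated derivative is a derivative of [f] along the differentiated components plus a
    Hessian term. The Hessian terms cancel by [derive_comm], and the rest is the bracket. Applied to
    frame coefficients, this is the vanishing of the normal curvature. *)
Lemma dir_derive_lie_bracket f V W (x : M) : smooth_fun setT f ->
  smooth_vfield setT V -> smooth_vfield setT W ->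
  dir_derive f x (lie_bracket V W x) =
  dir_derive (fun q => dir_derive f q (W q)) x (V x) -
  dir_derive (fun q => dir_derive f q (V q)) x (W x).
Proof.
move=> sf sV sW; have ix := chart_at_dom x.
have oT : open (coord_img (chart_at M x) (@setT M)).
  by apply: open_coord_img; exact: openT.
have Ty : coord_img (chart_at M x) setT (chart_map M (chart_at M x) x) by exists x.
rewrite !derive_dir_derive// /lie_bracket.
have df := smooth_fun_differentiable ix I sf.
set fc := f \o _ in df *; set y := chart_map M _ x in df *.
have L a b : 'D_(a - b) fc y = 'D_a fc y - 'D_b fc y.
  by rewrite !(deriveE _ df) linearB.
have aux (a b c d : R) : c = d -> a - b = a + c - (b + d) by move=> ->; ring.
apply: etrans (L _ _) (aux _ _ _ _ _).
exact: (derive_comm (W x) (V x) oT Ty (sf (chart_at M x) 2%N)).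
Qed.

End LieBracket.

(** * The ambient manifold *)

Section AmbientVectors.
Context {R : realType} {n : nat}.
Implicit Types v w : 'rV[R]_(2 + n).

(* The components of an ambient vector along d_t and d_rho. *)
Definition vt v : R := lsubmx v 0 0.
Definition vr v : R := lsubmx v 0 1.

Lemma ambient_vect_ext v w :
  vt v = vt w -> vr v = vr w -> rsubmx v = rsubmx w -> v = w.
Proof.
move=> et er ex; rewrite -[v]hsubmxK -[w]hsubmxK ex; congr row_mx.
apply/rowP => -[[|[|//]] lt].
  by rewrite (_ : Ordinal _ = 0) //; exact/val_inj.
by rewrite (_ : Ordinal _ = 1) //; exact/val_inj.
Qed.

Lemma vtD v w : vt (v + w) = vt v + vt w. Proof. by rewrite /vt !mxE. Qed.
Lemma vrD v w : vr (v + w) = vr v + vr w. Proof. by rewrite /vr !mxE. Qed.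
Lemma vtN v : vt (- v) = - vt v. Proof. by rewrite /vt !mxE. Qed.
Lemma vrN v : vr (- v) = - vr v. Proof. by rewrite /vr !mxE. Qed.
Lemma vtZ (a : R) v : vt (a *: v) = a * vt v. Proof. by rewrite /vt !mxE. Qed.
Lemma vrZ (a : R) v : vr (a *: v) = a * vr v. Proof. by rewrite /vr !mxE. Qed.

Lemma vt_row (a : 'rV[R]_2) (b : 'rV[R]_n) : vt (row_mx a b) = a 0 0.
Proof. by rewrite /vt row_mxKl. Qed.
Lemma vr_row (a : 'rV[R]_2) (b : 'rV[R]_n) : vr (row_mx a b) = a 0 1.
Proof. by rewrite /vr row_mxKl. Qed.

Lemma rsubmxD v w : rsubmx (v + w) = rsubmx v + rsubmx w.
Proof. exact: raddfD. Qed.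
Lemma rsubmxN v : rsubmx (- v) = - rsubmx v.
Proof. exact: raddfN. Qed.
Lemma rsubmxZ (a : R) v : rsubmx (a *: v) = a *: rsubmx v.
Proof. exact: linearZ. Qed.

Let row2E (k l : 'I_2) : (delta_mx 0 k : 'rV[R]_2) 0 l = (k == l)%:R.
Proof. by rewrite mxE eqxx eq_sym. Qed.

Definition ambient_vectE :=
  (vtD, vrD, vtN, vrN, vtZ, vrZ, (rsubmxD, rsubmxN, rsubmxZ),
   (vt_row, vr_row, @row_mxKr R 1 2 n, row2E)).

End AmbientVectors.

Lemma is_derive_vt (R : realType) n (z v : 'rV[R]_(2 + n)) :
  is_derive z v (fun y => vt y) (vt v).
Proof. exact: (is_derive_mxP _ _ _ _).2 (is_derive_lsubmx z v) _ _. Qed.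

Lemma is_derive_vr (R : realType) n (z v : 'rV[R]_(2 + n)) :
  is_derive z v (fun y => vr y) (vr v).
Proof. exact: (is_derive_mxP _ _ _ _).2 (is_derive_lsubmx z v) _ _. Qed.

Section AmbientCharts.
Context {R : realType} {n : nat} (M : manifold R n) (delta : {posnum R}).
Local Notation N := (ambient M delta).
Implicit Types (i j : chart M) (p q : N) (v w : 'rV[R]_(2 + n)).

(** Outside the box [ambient_param] falls back on a default point, so formulas for t and rho in
    coordinates are only available in such a neighbourhood. *)
Lemma near_ambient_box i p : \forall z \near ambient_coord i p, ambient_box delta z.
Proof.
apply: open_nbhs_nbhs; split; first exact: ambient_box_open.
exact: ambient_coord_box.
Qed.

(** Ambient charts share the coordinates t and rho, so a transition is the identity on them times a
    transition of [M], and its Jacobian is block diagonal. *)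
Lemma ambient_chart_change i j p v : chart_dom M i (mproj p) -> chart_dom M j (mproj p) ->
  v *m chart_change (M := N) i j p =
  row_mx (lsubmx v) (rsubmx v *m chart_change i j (mproj p)).
Proof.
move=> ip jp; apply: etrans (@mul_chart_change _ _ N i j p v ip jp) _.
pose tau := chart_map M j \o chart_inv M i.
have dtau : differentiable tau (rsubmx (ambient_coord i p)).
  by rewrite row_mxKr; exact: transition_differentiable.
have dr : is_derive (ambient_coord i p) v (fun z => tau (rsubmx z))
    (rsubmx v *m chart_change i j (mproj p)).
  have drs := @differentiable_rsubmx R 1 2 n (ambient_coord i p).
  apply: DeriveDef; first exact/diff_derivable/(differentiable_comp drs dtau).
  apply: etrans (derive_comp v drs dtau) _.
  have [_ ->] := is_derive_rsubmx (ambient_coord i p) v.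
  by rewrite row_mxKr -mul_chart_change.
have [_ <-] := is_derive_row_mx (is_derive_lsubmx (ambient_coord i p) v) dr.
apply: near_eq_derive.
have nd : \forall z \near ambient_coord i p, coord_img (M := N) i setT z.
  exact: (@near_coord_img _ _ N i p setT ip filterT).
apply: filterS nd => _ [q [iq _] <-].
rewrite /= ambient_coordK// row_mxKr /tau /= chart_mapK// row_mxKl.
by rewrite /ambient_coord.
Qed.

Lemma is_derive_tcoord i p v : is_derive (ambient_coord i p) v
  (@tcoord _ _ M delta \o ambient_param delta i) (vt v).
Proof.
apply: (@near_is_derive _ _ _ (fun z => vt z)).
  by apply: filterS (near_ambient_box i p) => z bz; have [] := ambient_paramE i bz.
exact: is_derive_vt.
Qed.

Lemma is_derive_rcoord i p v : is_derive (ambient_coord i p) v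
  (@rcoord _ _ M delta \o ambient_param delta i) (vr v).
Proof.
apply: (@near_is_derive _ _ _ (fun z => vr z)).
  by apply: filterS (near_ambient_box i p) => z bz; have [] := ambient_paramE i bz.
exact: is_derive_vr.
Qed.

End AmbientCharts.

Section PartialVectors.
Context {R : realType} {n : nat}.

Let vt_t : vt (partial_t : 'rV[R]_(2 + n)) = 1.
Proof. by rewrite /partial_t !ambient_vectE. Qed.
Let vr_t : vr (partial_t : 'rV[R]_(2 + n)) = 0.
Proof. by rewrite /partial_t !ambient_vectE. Qed.
Let vx_t : rsubmx (partial_t : 'rV[R]_(2 + n)) = 0.
Proof. by rewrite /partial_t !ambient_vectE. Qed.
Let vt_r : vt (partial_r : 'rV[R]_(2 + n)) = 0.
Proof. by rewrite /partial_r !ambient_vectE. Qed.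
Let vr_r : vr (partial_r : 'rV[R]_(2 + n)) = 1.
Proof. by rewrite /partial_r !ambient_vectE. Qed.
Let vx_r : rsubmx (partial_r : 'rV[R]_(2 + n)) = 0.
Proof. by rewrite /partial_r !ambient_vectE. Qed.
Let vt_x (a : 'rV[R]_n) : vt (lift_vect a) = 0.
Proof. by rewrite /lift_vect !ambient_vectE mxE. Qed.
Let vr_x (a : 'rV[R]_n) : vr (lift_vect a) = 0.
Proof. by rewrite /lift_vect !ambient_vectE mxE. Qed.
Let vx_x (a : 'rV[R]_n) : rsubmx (lift_vect a) = a.
Proof. by rewrite /lift_vect !ambient_vectE. Qed.

Definition partialE :=
  (vt_t, vr_t, vx_t, vt_r, vr_r, vx_r, vt_x, vr_x, vx_x).

End PartialVectors.

(** * The ambient metric in coordinates *)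

Section AmbientMetric.
Context {R : realType} {n : nat} (M : manifold R n) (delta : {posnum R}).
Context (g : tensor02 M) (alpha : R -> tensor11 M).
Local Notation N := (ambient M delta).
Local Notation gt := (ambient_metric delta g alpha).
Implicit Types (i j : chart M) (p q : N) (v w : 'rV[R]_(2 + n)).

Lemma differentiable_tcoord i p : differentiable
  (@tcoord _ _ M delta \o ambient_param delta i) (ambient_coord i p).
Proof.
apply: (@near_eq_diff _ _ _ (fun z : 'rV[R]_(2 + n) => z 0 (lshift n 0))).
  apply: filterS (near_ambient_box i p) => z bz.
  by have [/= -> _ _] := ambient_paramE i bz; rewrite mxE.
exact: differentiable_coord.
Qed.

Lemma differentiable_rcoord i p : differentiable
  (@rcoord _ _ M delta \o ambient_param delta i) (ambient_coord i p).
Proof.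
apply: (@near_eq_diff _ _ _ (fun z : 'rV[R]_(2 + n) => z 0 (lshift n 1))).
  apply: filterS (near_ambient_box i p) => z bz.
  by have [_ /= -> _] := ambient_paramE i bz; rewrite mxE.
exact: differentiable_coord.
Qed.

Lemma mul_dfun_tcoord p v :
  v *m dfun (M := N) (@tcoord _ _ M delta) p = (vt v)%:M.
Proof.
apply: etrans (@mul_dfun _ _ N (@tcoord _ _ M delta) p v
  (differentiable_tcoord (chart_at M (mproj p)) p)) _.
by congr (_%:M); have [_] := is_derive_tcoord (chart_at M (mproj p)) p v.
Qed.

Lemma mul_dfun_rtcoord p v :
  v *m dfun (M := N) (fun q => rcoord q * tcoord q) p =
  (rcoord p * vt v + tcoord p * vr v)%:M.
Proof.
set i := chart_at M (mproj p).
have dr := differentiable_rcoord i p; have dt := differentiable_tcoord i p.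
have ip : ambient_dom i p by exact: chart_at_dom.
have drt : differentiable ((fun q : N => rcoord q * tcoord q) \o
    ambient_param delta i) (ambient_coord i p).
  exact: differentiableM dr dt.
apply: etrans (@mul_dfun _ _ N (fun q => rcoord q * tcoord q) p v drt) _.
congr (_%:M).
have [_] := is_deriveM (is_derive_rcoord i p v) (is_derive_tcoord i p v).
by rewrite /= ambient_coordK.
Qed.

(** From d(rho t) = rho dt + t d rho: the symmetrised product with dt contributes twice rho dt^2 and
    a cross term weighted by t. *)
Lemma ambient_metricE p v w : bform (gt p) v w =
  2 * rcoord p * vt v * vt w + tcoord p * (vt v * vr w + vr v * vt w) +
  tcoord p ^+ 2 *
    bform (alpha (rcoord p) (mproj p) *m g (mproj p)) (rsubmx v) (rsubmx w).
Proof.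
have outer (a b : 'cV[R]_(2 + n)) :
    v *m (a *m b^T) *m w^T = (v *m a) *m (w *m b)^T by rewrite trmx_mul !mulmxA.
rewrite /bform /ambient_metric !mulmxDr !mulmxDl !outer !addmx00.
have := mul_dfun_tcoord p; have := mul_dfun_rtcoord p.
move: (dfun _ p) (dfun _ p) => b a bE aE; rewrite !aE !bE -scalemxAr -scalemxAl.
congr (_ + _); last first.
  rewrite -[in LHS](hsubmxK v) -[in LHS](hsubmxK w) mul_row_block.
  rewrite tr_row_mx mul_row_col !mulmx0 !addr0 !add0r mul0mx add0r.
  by rewrite mxE.
rewrite !tr_scalar_mx -!scalar_mxM !mxE !mulr1n; ring.
Qed.

Lemma ambient_metric_sym :
  (forall x, (g x)^T = g x) ->
  (forall r x a b, bform (g x) (a *m alpha r x) b = bform (g x) a (b *m alpha r x)) ->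
  forall p v w, bform (gt p) v w = bform (gt p) w v.
Proof.
move=> symg sa p v w; rewrite !ambient_metricE.
set H := bform _ (rsubmx v) _; have -> : H = bform (alpha (rcoord p) (mproj p) *m
    g (mproj p)) (rsubmx w) (rsubmx v).
  have mulE a b : bform (alpha (rcoord p) (mproj p) *m g (mproj p)) a b =
      bform (g (mproj p)) (a *m alpha (rcoord p) (mproj p)) b.
    by rewrite /bform !mulmxA.
  by rewrite /H !mulE sa bform_sym.
ring.
Qed.

(** Three tests in this order: [partial_r] pairs only with the t-component; once that vanishes,
    [partial_t] sees only the rho-component; the lifted vectors then detect the rest because [alpha]
    and [g] are invertible. *)
Lemma ambient_metric_nondegenerate p v :
  alpha (rcoord p) (mproj p) \in unitmx -> g (mproj p) \in unitmx ->
  (forall w, bform (gt p) v w = 0) -> v = 0.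
Proof.
move=> ua ug v0; have t0 := lt0r_neq0 (tcoord_gt0 p).
have vt0 : vt v = 0.
  have := v0 partial_r; rewrite ambient_metricE !partialE bform0r.
  rewrite !(mulr0, addr0, add0r, mulr1) => /eqP.
  by rewrite mulf_eq0 (negPf t0) => /eqP.
have vr0 : vr v = 0.
  have := v0 partial_t; rewrite ambient_metricE !partialE bform0r vt0.
  rewrite !(mulr0, mul0r, addr0, add0r, mulr1) => /eqP.
  by rewrite mulf_eq0 (negPf t0) => /eqP.
apply: ambient_vect_ext; rewrite ?vt0 ?vr0 ?[vt 0]mxE ?[vr 0]mxE ?mxE//.
suff vB : rsubmx v *m (alpha (rcoord p) (mproj p) *m g (mproj p)) = 0.
  by rewrite -[LHS](mulmxK ua) -[X in X *m _](mulmxK ug) -(mulmxA (rsubmx v)) vB !mul0mx raddf0.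
apply/rowP => k; have := v0 (lift_vect (delta_mx 0 k)).
rewrite ambient_metricE !partialE vt0 vr0 !(mulr0, mul0r, addr0, add0r).
move/eqP; rewrite mulf_eq0 expf_eq0 (negPf t0) andbF /= => /eqP.
by rewrite /bform trmx_delta -colE !mxE.
Qed.

Definition slice_metric (r : R) : tensor02 M := fun x => alpha r x *m g x.

Lemma ambient_metric_const_field i p v w : chart_dom M i (mproj p) ->
  bform (gt p) (const_field (M := N) i v p) (const_field (M := N) i w p) =
  2 * rcoord p * vt v * vt w + tcoord p * (vt v * vr w + vr v * vt w) +
  tcoord p ^+ 2 *
    bform (comp02 i (slice_metric (rcoord p)) (mproj p)) (rsubmx v) (rsubmx w).
Proof.
move=> ip; have pp := chart_at_dom (mproj p).
rewrite /const_field !ambient_chart_change// ambient_metricE.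
by rewrite !ambient_vectE bform_mul.
Qed.

Lemma comp02_ambient_metric i p v w : chart_dom M i (mproj p) ->
  bform (comp02 (M := N) i gt p) v w =
  2 * rcoord p * vt v * vt w + tcoord p * (vt v * vr w + vr v * vt w) +
  tcoord p ^+ 2 *
    bform (comp02 i (slice_metric (rcoord p)) (mproj p)) (rsubmx v) (rsubmx w).
Proof. by move=> ip; rewrite -ambient_metric_const_field// bform_mul. Qed.

(** Separates the two sources of smoothness: the components of [alpha], smooth jointly in the
    parameter and the point, and those of [g]. *)
Lemma comp02_slice_metric i r x : chart_dom M i x ->
  comp02 i (slice_metric r) x = comp11 i (alpha r) x *m comp02 i g x.
Proof.
move=> ix; have := chart_changeK (chart_at_dom x) ix; rewrite /comp02 /comp11.
move: (chart_change _ i x) (chart_change i _ x) => A B AB.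
by rewrite !mulmxA -(mulmxA _ A B) AB mulmx1.
Qed.

Lemma ambient_coord_parts i p :
  [/\ vt (ambient_coord i p) = tcoord p, vr (ambient_coord i p) = rcoord p &
      rsubmx (ambient_coord i p) = chart_map M i (mproj p)].
Proof. by split; rewrite !ambient_vectE ?mxE. Qed.

(** Compatibility along the immersion requires a differentiable metric matrix. In a chart its
    entries are polynomials in t, rho and the components of [alpha] and [g]. *)
Lemma smooth_ambient_metric : smooth_family alpha -> smooth_tensor02 g ->
  smooth_tensor02 gt.
Proof.
move=> sa sg; change (forall i : chart M, smooth_on (coord_img (M := N) i setT)
  (comp02 (M := N) i gt \o chart_inv N i)); move=> i k.
have oN : open (coord_img (M := N) i (@setT N)).
  exact: (@open_coord_img _ _ N i setT openT).
have oM : open (coord_img i (@setT M)) by apply: open_coord_img; exact: openT.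
have imgP z : coord_img (M := N) i setT z -> coord_img i setT (rsubmx z).
  by move=> [p [ip _] <-]; rewrite row_mxKr; exists (mproj p).
have Ct : class_C k (coord_img (M := N) i setT) (fun z : 'rV[R]_(2 + n) => vt z).
  rewrite (_ : (fun z => _) = (fun z : 'rV[R]_(2 + n) => z 0 (lshift n 0))).
    exact: class_C_entry (class_C_id _ _).
  by apply/funext => z; rewrite /vt mxE.
have Cr : class_C k (coord_img (M := N) i setT) (fun z : 'rV[R]_(2 + n) => vr z).
  rewrite (_ : (fun z => _) = (fun z : 'rV[R]_(2 + n) => z 0 (lshift n 1))).
    exact: class_C_entry (class_C_id _ _).
  by apply/funext => z; rewrite /vr mxE.
have Cx : class_C k (coord_img (M := N) i setT) (@rsubmx R 1 2 n).
  apply: (class_C_lin (L := rsubmx) (f := id)) => //.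
    exact: continuous_rsubmx.
  exact: class_C_id.
have C11 : class_C k (coord_img (M := N) i setT) (fun z : 'rV[R]_(2 + n) =>
    comp11 i (alpha (vr z)) (chart_inv M i (rsubmx z))).
  (* [smooth_family] reads the parameter and the point from one row of length 1 + n; [h] forgets t
     in (t, rho, x). *)
  pose h (z : 'rV[R]_(2 + n)) : 'rV[R]_(1 + n) := row_mx (vr z *: delta_mx 0 0) (rsubmx z).
  have o1 : open [set z : 'rV[R]_(1 + n) | coord_img i setT (rsubmx z)].
    by apply: open_comp oM => z _; exact: continuous_rsubmx.
  have hx z : rsubmx (h z) = rsubmx z by rewrite /h row_mxKr.
  have hr z : lsubmx (h z) 0 0 = vr z by rewrite /h row_mxKl !mxE !eqxx mulr1.
  have Ch : class_C k (coord_img (M := N) i setT) h.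
    by apply: class_C_row_mx => //; exact: class_C_scalel.
  have hI z : coord_img (M := N) i setT z -> coord_img i setT (rsubmx (h z)).
    by rewrite hx; exact: imgP.
  have C := class_C_comp oN o1 hI Ch (sa i k).
  apply: (class_C_ext oN _ C) => z _.
  by rewrite -(hx z) -(hr z).
have C02 : class_C k (coord_img (M := N) i setT) (fun z : 'rV[R]_(2 + n) =>
    comp02 i g (chart_inv M i (rsubmx z))).
  exact: (class_C_comp (h := rsubmx) oN oM imgP Cx (sg i k)).
apply: class_C_mx => // a b.
pose ea : 'rV[R]_(2 + n) := delta_mx 0 a; pose eb : 'rV[R]_(2 + n) := delta_mx 0 b.
pose H (z : 'rV[R]_(2 + n)) := bform (comp11 i (alpha (vr z)) (chart_inv M i (rsubmx z)) *m
    comp02 i g (chart_inv M i (rsubmx z))) (rsubmx ea) (rsubmx eb).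
pose F z := (2 * vt ea * vt eb) * vr z +
  (vt ea * vr eb + vr ea * vt eb) * vt z + (vt z * vt z) * H z.
apply: (@class_C_ext _ _ _ _ _ F) => //.
  move=> _ [p [ip _] <-].
  have E := comp02_ambient_metric ea eb ip; rewrite bform_delta in E.
  have pE : ambient_param delta i (ambient_coord i p) = p := ambient_coordK ip.
  apply: esym; apply: etrans (etrans (congr1 (fun q : N => comp02 (M := N) i gt q a b) pE) E) _.
  clearbody ea eb; have [et er ex] := ambient_coord_parts i p.
  have invE : chart_inv M i (rsubmx (ambient_coord i p)) = mproj p.
    by rewrite ex chart_mapK.
  rewrite (comp02_slice_metric (rcoord p) ip).
  suff -> : F (chart_map N i p) = 2 * vt ea * vt eb * rcoord p +
      (vt ea * vr eb + vr ea * vt eb) * tcoord p + (tcoord p * tcoord p) *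
      bform (comp11 i (alpha (rcoord p)) (mproj p) *m comp02 i g (mproj p))
        (rsubmx ea) (rsubmx eb).
    congr (_ + _).
    move: (tcoord p) (rcoord p) (vt ea) (vt eb) (vr ea) (vr eb) => *; ring.
  by rewrite /F /H et er invE.
have Cc (c : R) : class_C k (coord_img (M := N) i setT) (fun _ : 'rV[R]_(2 + n) => c).
  exact: class_C_cst.
apply: class_CD => //; last first.
  apply: class_CM => //; first exact: class_CM.
  apply: class_C_entry => //; apply: class_C_mulmx => //; last exact: class_C_cst.
  apply: class_C_mulmx => //; first exact: class_C_cst.
  exact: class_C_mulmx.
by apply: class_CD => //; exact: class_CM.
Qed.

End AmbientMetric.

(** * The homothetic field *)

Section Homothety.
Context {R : realType} {n : nat} (M : manifold R n) (delta : {posnum R}).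
Context (g : tensor02 M) (alpha : R -> tensor11 M).
Local Notation N := (ambient M delta).
Local Notation gt := (ambient_metric delta g alpha).
Context (D : connection N).
Hypothesis D_lc : levi_civita gt D.
Hypothesis g_riem : riemannian g.
Hypothesis alpha_sym : forall r x a b,
  bform (g x) (a *m alpha r x) b = bform (g x) a (b *m alpha r x).
Hypothesis alpha_unit : nonsingular_below alpha delta%:num.
Implicit Types (p : N) (a b v w : 'rV[R]_(2 + n)).

Local Notation F p := (const_field (M := N) (chart_at M (mproj p))).

(** Paired with [partial_t], the block containing [alpha] drops out and 2 rho b_t + t b_rho remains,
    linear in the coordinates. *)
Lemma derive_metric_partial_t p a b :
  dir_derive (M := N) (fun q => bform (gt q) (F p partial_t q) (F p b q)) p a =
  2 * vr a * vt b + vt a * vr b.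
Proof.
set i := chart_at M (mproj p).
have ip : chart_dom N i p by exact: chart_at_dom.
pose f (z : 'rV[R]_(2 + n)) := 2 * vt b * vr z + vr b * vt z.
have nf : {near ambient_coord i p, f =1
    (fun q => bform (gt q) (F p partial_t q) (F p b q)) \o ambient_param delta i}.
  apply: (@near_chartW _ _ N i p _ ip) => q iq.
  have qE : ambient_param delta i (ambient_coord i q) = q := ambient_coordK iq.
  have [et er _] := ambient_coord_parts i q.
  apply: esym; apply: etrans (congr1 (fun q : N =>
    bform (gt q) (F p partial_t q) (F p b q)) qE) _.
  apply: etrans (ambient_metric_const_field _ _ _ _ iq) _.
  by rewrite !partialE bform0l /f et er; ring.
have [_ E] := is_deriveD (is_deriveZ (2 * vt b) (is_derive_vr (ambient_coord i p) a))
  (is_deriveZ (vr b) (is_derive_vt (ambient_coord i p) a)).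
rewrite /dir_derive; apply: etrans (etrans _ E) _.
  exact/esym/(near_eq_derive _ nf).
move: (vr a) (vt a) (vr b) (vt b) => ra ta rb tb.
by rewrite /GRing.scale /=; ring.
Qed.

(** [alpha] depends on rho and the point only, so along d_t it is constant and just the explicit
    powers of t are differentiated. *)
Lemma derive_metric_along_t p a b :
  dir_derive (M := N) (fun q => bform (gt q) (F p a q) (F p b q)) p partial_t =
  (vt a * vr b + vr a * vt b) + 2 * tcoord p *
    bform (slice_metric g alpha (rcoord p) (mproj p)) (rsubmx a) (rsubmx b).
Proof.
set i := chart_at M (mproj p).
have ip : chart_dom N i p by exact: chart_at_dom.
pose H (z : 'rV[R]_(2 + n)) := bform (comp02 i (slice_metric g alpha (vr z))
  (chart_inv M i (rsubmx z))) (rsubmx a) (rsubmx b).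
pose f (z : 'rV[R]_(2 + n)) := 2 * vt a * vt b * vr z +
  (vt a * vr b + vr a * vt b) * vt z + vt z * vt z * H z.
have nf : {near ambient_coord i p, f =1
    (fun q => bform (gt q) (F p a q) (F p b q)) \o ambient_param delta i}.
  apply: (@near_chartW _ _ N i p _ ip) => q iq.
  have qE : ambient_param delta i (ambient_coord i q) = q := ambient_coordK iq.
  have [et er ex] := ambient_coord_parts i q.
  apply: esym; apply: etrans (congr1 (fun q : N =>
    bform (gt q) (F p a q) (F p b q)) qE) _.
  apply: etrans (ambient_metric_const_field _ _ _ _ iq) _.
  rewrite /f /H et er ex chart_mapK//; congr (_ + _).
  move: (tcoord q) (rcoord q) (vt a) (vr a) (vt b) (vr b) => *; ring.
have [et er ex] := ambient_coord_parts i p.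
set z := ambient_coord i p in nf et er ex *.
have dH : is_derive z partial_t H 0.
  apply: is_derive_constant_line => h.
  by rewrite /H !ambient_vectE /= mulr0 scaler0 !add0r.
have Hz : H z = bform (slice_metric g alpha (rcoord p) (mproj p)) (rsubmx a) (rsubmx b).
  rewrite /H er ex chart_mapK// /comp02 chart_change_id//.
  by rewrite mul1mx trmx1 mulmx1.
have dt := is_derive_vt z partial_t; have dr := is_derive_vr z partial_t.
have df := is_deriveD (is_deriveD (is_deriveZ (2 * vt a * vt b) dr)
  (is_deriveZ (vt a * vr b + vr a * vt b) dt)) (is_deriveM (is_deriveM dt dt) dH).
have [_ E] := df.
rewrite /dir_derive; apply: etrans (etrans _ E) _.
  exact/esym/(near_eq_derive _ nf).
rewrite /= !partialE et Hz !scaler0 add0r; move: (bform _ _ _) => h.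
move: (tcoord p) (vt a) (vr a) (vt b) (vr b) => *.
by rewrite /GRing.scale /=; ring.
Qed.

(** This is D_a (t d_t) = a with the Leibniz term moved to the right. It is stated for the
    coordinate field d_t because [pullback_connection] applies [D] to coordinate fields. *)
Lemma homothetic_field p a :
  tcoord p *: D p a (F p partial_t) = a - vt a *: partial_t.
Proof.
have [_ tf mc] := D_lc.
have g_sym := riemannian_sym g_riem.
have gt_sym := ambient_metric_sym (delta := delta) g_sym alpha_sym.
have sF b : smooth_near_vfield (M := N) p (F p b).
  by apply: (@const_field_smooth_near _ _ N); exact: chart_at_dom.
have Fp b : F p b p = b by exact: (@const_field_at _ _ N).
have tfF b c : D p b (F p c) = D p c (F p b).
  have := tf p (F p b) (F p c) (sF b) (sF c).
  rewrite !Fp (lie_bracket_const_field (M := N)) => /eqP.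
  by rewrite subr_eq0 => /eqP.
(* [e1], [e2], [e3] below are the three terms of the Koszul formula. *)
suff kos b : bform (gt p) (tcoord p *: D p a (F p partial_t)) b =
    bform (gt p) (a - vt a *: partial_t) b.
  apply/eqP; rewrite -subr_eq0; apply/eqP.
  apply: (@ambient_metric_nondegenerate _ _ _ _ g alpha p).
  - by apply: alpha_unit; exact: rcoord_lt.
  - exact: riemannian_unit.
  - by move=> b; rewrite bformDl bformNl kos subrr.
have e1 := mc p a _ _ (sF partial_t) (sF b).
have e2 := mc p partial_t _ _ (sF a) (sF b).
have e3 := mc p b _ _ (sF partial_t) (sF a).
rewrite derive_metric_partial_t !Fp in e1.
rewrite derive_metric_along_t !Fp !(tfF partial_t) in e2.
rewrite derive_metric_partial_t !Fp (tfF b a) in e3.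
rewrite (gt_sym _ (D p b _)) in e3.
(* Subtracting the t-part of [a] cancels every term containing [vt a]. The factor [tcoord p] left
   over matches the one on the other side, and half of [e1 + e2 - e3] is the cofactor. *)
have -> : bform (gt p) (a - vt a *: partial_t) b =
    tcoord p * (vr a * vt b + tcoord p *
    bform (slice_metric g alpha (rcoord p) (mproj p)) (rsubmx a) (rsubmx b)).
  rewrite bformDl bformNl bformZl !ambient_metricE !partialE bform0l.
  rewrite /slice_metric; set h := bform _ _ _; move: h => h.
  move: (tcoord p) (rcoord p) (vt a) (vr a) (vt b) (vr b) => *; ring.
rewrite bformZl; congr (_ * _).
move: (bform (gt p) (D p a _) b) (bform (gt p) partial_t _)
  (bform (gt p) a _) (bform (slice_metric _ _ _ _) _ _) e1 e2 e3.
move: (tcoord p) (vt a) (vr a) (vt b) (vr b) => t ta ra tb rb x y z h.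
by move=> e1 e2 e3; lra.
Qed.

End Homothety.

(** * The immersion and its normal bundle *)

Section SmoothFunctions.
Context {R : realType} {n : nat} (M : manifold R n).
Implicit Types (f h : M -> R) (X : vfield M).

Let oT i : open (coord_img i (@setT M)).
Proof. by apply: open_coord_img; exact: openT. Qed.

Lemma smooth_fun_cst (a : R) : smooth_fun setT (fun _ : M => a).
Proof. by move=> i k; exact: class_C_cst. Qed.

Lemma smooth_funD f h : smooth_fun setT f -> smooth_fun setT h ->
  smooth_fun setT (fun x => f x + h x).
Proof. by move=> sf sh i k; exact: (class_CD (@oT i) (sf i k) (sh i k)). Qed.

Lemma smooth_funM f h : smooth_fun setT f -> smooth_fun setT h ->
  smooth_fun setT (fun x => f x * h x).
Proof. by move=> sf sh i k; exact: (class_CM (@oT i) (sf i k) (sh i k)). Qed.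

Lemma smooth_funN f : smooth_fun setT f -> smooth_fun setT (fun x => - f x).
Proof.
move=> sf; rewrite (_ : (fun x => _) = fun x => -1 * f x).
  by apply: smooth_funM => //; exact: smooth_fun_cst.
by apply/funext => x; rewrite mulN1r.
Qed.

Lemma smooth_fun_expR f : smooth_fun setT f -> smooth_fun setT (fun x => expR (f x)).
Proof. by move=> sf i k; exact: (class_C_expR (@oT i) (sf i k)). Qed.

Lemma smooth_vfieldZ f X : smooth_fun setT f -> smooth_vfield setT X ->
  smooth_vfield setT (fun x => f x *: X x).
Proof.
move=> sf sX i k; have C := class_C_scale (@oT i) (sf i k) (sX i k).
by apply: class_C_ext C => // y _; rewrite /= /vcomp -scalemxAl.
Qed.

Lemma smooth_vfield0 : smooth_vfield setT (fun _ : M => 0 : 'rV[R]_n).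
Proof.
move=> i k; apply: class_C_ext (class_C_cst k _ (0 : 'rV[R]_n)) => // y _.
by rewrite /= /vcomp mul0mx.
Qed.

Lemma smooth_fun_differentiable_at f x : smooth_fun setT f -> differentiable_fun_at f x.
Proof. by move=> sf; exact: smooth_fun_differentiable (chart_at_dom x) I sf. Qed.

Lemma dir_derive_cst (a : R) x v : dir_derive (fun _ : M => a) x v = 0.
Proof. exact: derive_cst. Qed.

Lemma dir_derive_linear f x (a : R) v w : differentiable_fun_at f x ->
  dir_derive f x (a *: v + w) = a * dir_derive f x v + dir_derive f x w.
Proof. by move=> df; rewrite /dir_derive !(deriveE _ df) linearP. Qed.

End SmoothFunctions.

Section Slice.
Context {R : realType} {n : nat} (M : manifold R n) (delta : {posnum R}).
Context (u : M -> R).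
Hypothesis u_smooth : smooth_fun setT u.
Local Notation N := (ambient M delta).
Local Notation Psi := (Psi delta u).
Implicit Types (x : M) (v : 'rV[R]_n) (Z : M -> 'rV[R]_(2 + n)).

Let ambient_coord_Psi i x :
  ambient_coord i (Psi x) = row_mx (expR (u x) *: delta_mx 0 0) (chart_map M i x).
Proof.
apply: ambient_vect_ext; rewrite !ambient_vectE ?mxE /= ?mulr1 ?mulr0 //.
Qed.

Let is_derive_Psi x v : is_derive (chart_map M (chart_at M x) x) v
  (chart_map N (chart_at N (Psi x)) \o Psi \o chart_inv M (chart_at M x))
  (row_mx ((expR (u x) * dir_derive u x v) *: delta_mx 0 0) v).
Proof.
set i := chart_at M x; have ix : chart_dom M i x by exact: chart_at_dom.
pose uc := u \o chart_inv M i.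
have duc : differentiable uc (chart_map M i x).
  exact: smooth_fun_differentiable ix I u_smooth.
have := is_derive_expR_comp v duc; rewrite {2}/uc /= chart_mapK// => de.
have dc : is_derive (chart_map M i x) v (fun=> delta_mx 0 0 : 'rV[R]_2) 0.
  exact: is_derive_cst.
have := is_derive_row_mx (is_derive_scalemx de dc) (is_derive_id _ v).
rewrite scaler0 addr0; apply: near_is_derive.
apply: near_chartW => // q iq.
by rewrite /= /uc /= ambient_coord_Psi chart_mapK.
Qed.

Lemma differentiable_Psi x : differentiable
  (chart_map N (chart_at N (Psi x)) \o Psi \o chart_inv M (chart_at M x))
  (chart_map M (chart_at M x) x).
Proof.
set i := chart_at M x; have ix : chart_dom M i x by exact: chart_at_dom.
have C : class_C 1 (coord_img i setT) (fun y => row_mx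
    (expR ((u \o chart_inv M i) y) *: delta_mx 0 0 : 'rV[R]_2) y).
  have oT : open (coord_img i (@setT M)) by apply: open_coord_img; exact: openT.
  apply: class_C_row_mx => //; last exact: class_C_id.
  by apply: class_C_scalel => //; apply: class_C_expR => //; exact: u_smooth.
apply: near_eq_diff (C.1 _ _); last by exists x.
apply: near_chartW => // q iq.
by rewrite /= ambient_coord_Psi chart_mapK.
Qed.

Lemma mul_differential_Psi x v : v *m differential Psi x =
  row_mx ((expR (u x) * dir_derive u x v) *: delta_mx 0 0) v.
Proof.
have [_ <-] := is_derive_Psi x v.
by rewrite (deriveEjacobian _ (differentiable_Psi x)).
Qed.

Lemma acomp_Psi i Z x : chart_dom M i x ->
  acomp Psi i Z x = row_mx (lsubmx (Z x)) (vcomp i (fun y => rsubmx (Z y)) x).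
Proof.
move=> ix; apply: (@ambient_chart_change _ _ M delta (chart_at M x) i (Psi x)) => //.
exact: chart_at_dom.
Qed.

(** Ambient charts are indexed by those of [M], so it is enough to read [Z] with the same index on
    both sides; its t- and rho-components are the same in every chart. *)
Lemma smooth_along_parts Z : smooth_along Psi Z ->
  [/\ smooth_fun setT (fun x => vt (Z x)), smooth_fun setT (fun x => vr (Z x)) &
      smooth_vfield setT (fun x => rsubmx (Z x))].
Proof.
move=> sZ; have oT i : open (coord_img i (@setT M)).
  by apply: open_coord_img; exact: openT.
have CZ (i : chart M) k : class_C k (coord_img i setT) (acomp Psi i Z \o chart_inv M i).
  apply: class_C_sub (sZ i i k) => _ [q [iq _] <-].
  by exists q => //; split.
have ZE (i : chart M) y : coord_img i setT y -> (acomp Psi i Z \o chart_inv M i) y =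
    row_mx (lsubmx (Z (chart_inv M i y)))
      (vcomp i (fun y => rsubmx (Z y)) (chart_inv M i y)).
  by move=> [q [iq _] <-]; rewrite /= chart_mapK// acomp_Psi.
split=> i k.
- apply: class_C_ext (class_C_entry 0 (lshift n 0) (oT i) (CZ i k)) => // y /ZE ->.
  by rewrite row_mxEl.
- apply: class_C_ext (class_C_entry 0 (lshift n 1) (oT i) (CZ i k)) => // y /ZE ->.
  by rewrite row_mxEl.
apply: class_C_mx => // a b; rewrite ord1.
apply: class_C_ext (class_C_entry 0 (rshift 2 b) (oT i) (CZ i k)) => // y /ZE ->.
by rewrite row_mxEr.
Qed.

Lemma differentiable_along_parts Z x :
  smooth_fun setT (fun y => vt (Z y)) -> smooth_fun setT (fun y => vr (Z y)) ->
  smooth_vfield setT (fun y => rsubmx (Z y)) -> differentiable_along_at Psi Z x.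
Proof.
move=> st sr sx; set i := chart_at M x.
have ix : chart_dom M i x by exact: chart_at_dom.
have oT : open (coord_img i (@setT M)) by apply: open_coord_img; exact: openT.
have C : class_C 1 (coord_img i setT) (fun y => row_mx
    (vt (Z (chart_inv M i y)) *: delta_mx 0 0 +
     vr (Z (chart_inv M i y)) *: delta_mx 0 1 : 'rV[R]_2)
    ((vcomp i (fun y => rsubmx (Z y)) \o chart_inv M i) y)).
  apply: (class_C_row_mx oT _ (sx i 1%N)); apply: (class_CD oT).
    exact: (class_C_scalel _ oT (st i 1%N)).
  exact: (class_C_scalel _ oT (sr i 1%N)).
apply: near_eq_diff (C.1 _ _); last by exists x.
apply: near_chartW => // q iq.
rewrite /= chart_mapK//; apply: esym; apply: etrans (acomp_Psi _ iq) _.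
congr row_mx; apply/rowP => -[[|[|//]] lt]; rewrite !mxE /= ?mulr1 ?mulr0 ?addr0 ?add0r.
  by rewrite /vt !mxE; congr (Z q _ _); exact/val_inj.
by rewrite /vr !mxE; congr (Z q _ _); exact/val_inj.
Qed.

End Slice.

(** * The lightlike frame of the normal bundle *)

Section NormalFrame.
Context {R : realType} {n : nat} (M : manifold R n) (delta : {posnum R}).
Context (g : tensor02 M) (alpha : R -> tensor11 M) (u : M -> R).
Hypothesis g_riem : riemannian g.
Hypothesis alpha0 : forall x, alpha 0 x = 1%:M.
Hypothesis u_smooth : smooth_fun setT u.
Local Notation N := (ambient M delta).
Local Notation gt := (ambient_metric delta g alpha).
Local Notation Psi := (Psi delta u).
Local Notation grad := (gradient g u).
Local Notation xi := (xi_field u).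
Local Notation eta := (eta_field g u).
Local Notation G x := (bform (gt (Psi x))).
Implicit Types (x : M) (v : 'rV[R]_n) (w : 'rV[R]_(2 + n)).

(** The image lies in rho = 0, where the dt^2 term vanishes and [alpha] is the identity. *)
Lemma metric_slice x w1 w2 : G x w1 w2 =
  expR (u x) * (vt w1 * vr w2 + vr w1 * vt w2) +
  expR (u x) ^+ 2 * bform (g x) (rsubmx w1) (rsubmx w2).
Proof.
rewrite ambient_metricE; have -> : rcoord (Psi x) = 0 by [].
by rewrite alpha0 mul1mx mulr0 !mul0r add0r.
Qed.

Let expRN2 x : expR (- 2 * u x) = (expR (u x))^-1 ^+ 2.
Proof. by rewrite mulNr expRN mulrDl mul1r expRD invfM. Qed.

Let xiE x : [/\ vt (xi x) = expR (u x), vr (xi x) = 0 & rsubmx (xi x) = 0].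
Proof.
by rewrite /xi_field; split; rewrite !(vtZ, vrZ, rsubmxZ) partialE ?mulr1 ?mulr0 ?scaler0.
Qed.

(** The squared norm of the gradient is rewritten as du(grad u), to match the du(v) in the
    t-component of tangent vectors. *)
Let etaE x : [/\ vt (eta x) = (expR (u x))^-1 * (dir_derive u x (grad x) / 2),
   vr (eta x) = - (expR (u x))^-1 ^+ 2 &
   rsubmx (eta x) = (expR (u x))^-1 ^+ 2 *: grad x].
Proof.
rewrite /eta_field -(gradientP g_riem) // -expRN2 -expRN.
split; rewrite !(vtD, vrD, vtN, vrN, vtZ, vrZ, rsubmxD, rsubmxN, rsubmxZ) !partialE.
- by rewrite !mulr0 mulr1 subr0 addr0.
- by rewrite !mulr0 mulr1 sub0r addr0.
- by rewrite !scaler0 subr0 add0r.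
Qed.

Let tangentE x v : [/\ vt (v *m differential Psi x) = expR (u x) * dir_derive u x v,
   vr (v *m differential Psi x) = 0 & rsubmx (v *m differential Psi x) = v].
Proof.
rewrite mul_differential_Psi//.
by split; rewrite !ambient_vectE ?mxE /= ?mulr1 ?mulr0.
Qed.

Let e_neq0 x : expR (u x) != 0. Proof. exact/lt0r_neq0/expR_gt0. Qed.

Lemma xi_eta x : G x (xi x) (eta x) = -1.
Proof.
have [t r s] := xiE x; have [t' r' s'] := etaE x.
rewrite metric_slice t r s r' bform0l; move: (expR _) (e_neq0 x) => e e0.
by field.
Qed.

(** With q the squared norm of the gradient, the cross term gives - e^{-2u} q and the spatial term
    e^{-2u} q; the factor 1/2 in [eta_field] is there for this. *)
Lemma eta_lightlike x : G x (eta x) (eta x) = 0.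
Proof.
have [t r s] := etaE x.
rewrite metric_slice t r s bformZl bformZr (gradientP g_riem)//.
by move: (expR _) (e_neq0 x) (dir_derive _ _ _) => e e0 q; field.
Qed.

Lemma xi_tangent x v : G x (xi x) (v *m differential Psi x) = 0.
Proof.
have [t r s] := xiE x; have [t' r' s'] := tangentE x v.
by rewrite metric_slice r s r' bform0l !(mulr0, mul0r, addr0).
Qed.

(** The d_rho part of [eta] meets the t-component of dPsi(v) and gives - du(v); the gradient part
    gives du(v). *)
Lemma eta_tangent x v : G x (eta x) (v *m differential Psi x) = 0.
Proof.
have [t r s] := etaE x; have [t' r' s'] := tangentE x v.
rewrite metric_slice r t' r' s s' bformZl (gradientP g_riem)//.
by move: (expR _) (e_neq0 x) (dir_derive _ _ _) => e e0 q; field.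
Qed.

Lemma metric_tangent x v1 v2 :
  G x (v1 *m differential Psi x) (v2 *m differential Psi x) =
  expR (u x) ^+ 2 * bform (g x) v1 v2.
Proof.
have [t r s] := tangentE x v1; have [t' r' s'] := tangentE x v2.
by rewrite metric_slice r r' s s' !(mulr0, mul0r, addr0, add0r).
Qed.

(** Only [eta] has a rho-component, so its coefficient is forced to be - e^{2u} w_rho. Its gradient
    part then contributes - w_rho grad u, which the tangential vector has to compensate. *)
Lemma frame_decomposition x w :
  w = - G x w (eta x) *: xi x - G x w (xi x) *: eta x +
      (rsubmx w + vr w *: grad x) *m differential Psi x.
Proof.
have [t r s] := xiE x; have [t' r' s'] := etaE x.
have [t2 r2 s2] := tangentE x (rsubmx w + vr w *: grad x).
have du := smooth_fun_differentiable_at x u_smooth.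
have g_sym := riemannian_sym g_riem x.
have Dg : dir_derive u x (rsubmx w + vr w *: grad x) =
    dir_derive u x (rsubmx w) + vr w * dir_derive u x (grad x).
  by rewrite addrC (dir_derive_linear _ _ _ du) addrC.
have Gxi : G x w (xi x) = expR (u x) ^+ 2 * vr w.
  by rewrite metric_slice t r s bform0r !(mulr0, add0r, addr0) mulrCA mulrC expr2; ring.
have Geta : G x w (eta x) = - (expR (u x))^-1 * vt w +
    vr w * (dir_derive u x (grad x) / 2) + dir_derive u x (rsubmx w).
  rewrite metric_slice t' r' s' bformZr bform_sym// (gradientP g_riem)//.
  by move: (expR _) (e_neq0 x) (dir_derive _ _ _) (dir_derive _ _ _) => e e0 q d; field.
rewrite Gxi Geta; clear Gxi Geta.
move: (xi x) (eta x) ((rsubmx w + _) *m _) t r s t' r' s' t2 r2 s2.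
move=> X Y T t r s t' r' s' t2 r2 s2; apply: ambient_vect_ext.
- rewrite !(vtD, vtN, vtZ) t t' t2 Dg.
  by move: (expR _) (e_neq0 x) (dir_derive _ _ _) (dir_derive _ _ _) => e e0 q d; field.
- rewrite !(vrD, vrN, vrZ) r r' r2.
  by move: (expR _) (e_neq0 x) (dir_derive _ _ _) (dir_derive _ _ _) => e e0 q d; field.
rewrite !(rsubmxD, rsubmxN, rsubmxZ) s s' s2 scaler0 sub0r scalerA.
rewrite addrCA -scaleNr -scalerDl.
rewrite (_ : _ + vr w = 0) ?scale0r ?addr0//.
by move: (expR _) (e_neq0 x) => e e0; field.
Qed.

Lemma normal_spaceP x w : reflect (forall v, G x w (v *m differential Psi x) = 0)
  (w <= Defs.normal_space gt Psi x)%MS.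
Proof.
apply: (iffP sub_kermxP) => [w0 v|w0].
  by rewrite /bform trmx_mul -mulmxA [gt _ *m (_ *m _)]mulmxA mulmxA w0 mul0mx mxE.
apply/rowP => k; have := w0 (delta_mx 0 k); rewrite /bform trmx_mul trmx_delta.
by rewrite mulmxA -(mulmxA w) -colE mxE => ->; rewrite mxE.
Qed.

(** [proj_mx] is a projection only along complementary spaces. In a Lorentzian space a subspace may
    meet its orthogonal; here the induced metric e^{2u} g is positive definite, which excludes
    it. *)
Lemma normal_tangent_disjoint x :
  (Defs.normal_space gt Psi x :&: tangent_space Psi x)%MS = 0.
Proof.
apply/eqP; rewrite -submx0; apply/rV_subP => w.
rewrite sub_capmx genmxE => /andP[/normal_spaceP wn /submxP[v wE]].
have := wn v; rewrite wE metric_tangent => /eqP.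
rewrite mulf_eq0 expf_eq0 (negPf (e_neq0 x)) andbF /= => /eqP gv.
have [->|v0] := eqVneq v 0; first by rewrite mul0mx sub0mx.
by have [_ _ /(_ x v v0)] := g_riem; rewrite gv ltxx.
Qed.

Lemma xi_normal x : (xi x <= Defs.normal_space gt Psi x)%MS.
Proof. by apply/normal_spaceP; exact: xi_tangent. Qed.

Lemma eta_normal x : (eta x <= Defs.normal_space gt Psi x)%MS.
Proof. by apply/normal_spaceP; exact: eta_tangent. Qed.

Lemma normal_part_id x w : (w <= Defs.normal_space gt Psi x)%MS ->
  normal_part gt Psi x w = w.
Proof. by move=> wn; rewrite /normal_part proj_mx_id// normal_tangent_disjoint. Qed.

(** Makes the abstract projection explicit: a normal part vanishes as soon as two scalar pairings
    do. *)
Lemma normal_partE x w : normal_part gt Psi x w =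
  - G x w (eta x) *: xi x - G x w (xi x) *: eta x.
Proof.
rewrite {1}[w](frame_decomposition x) /normal_part mulmxDl.
set n1 := - _ *: _ - _.
have n1n : (n1 <= Defs.normal_space gt Psi x)%MS.
  rewrite /n1 -scaleNr; apply: addmx_sub; apply: scalemx_sub.
    exact: xi_normal.
  exact: eta_normal.
rewrite [n1 *m _](normal_part_id n1n) proj_mx_0 ?addr0 ?normal_tangent_disjoint//.
by rewrite genmxE submxMl.
Qed.

End NormalFrame.

(** * The normal connection in the lightlike frame *)

Section NormalConnection.
Context {R : realType} {n : nat} (M : manifold R n) (delta : {posnum R}).
Context (g : tensor02 M) (alpha : R -> tensor11 M) (u : M -> R).
Local Notation N := (ambient M delta).
Local Notation gt := (ambient_metric delta g alpha).
Context (D : connection N).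
Hypothesis D_lc : levi_civita gt D.
Hypothesis g_riem : riemannian g.
Hypothesis alpha_smooth : smooth_family alpha.
Hypothesis alpha_sym : forall r x a b,
  bform (g x) (a *m alpha r x) b = bform (g x) a (b *m alpha r x).
Hypothesis alpha_unit : nonsingular_below alpha delta%:num.
Hypothesis alpha0 : forall x, alpha 0 x = 1%:M.
Hypothesis u_smooth : smooth_fun setT u.
Local Notation Psi := (Psi delta u).
Local Notation grad := (gradient g u).
Local Notation xi := (xi_field u).
Local Notation eta := (eta_field g u).
Local Notation G x := (bform (gt (Psi x))).
Local Notation nabla := (pullback_connection D Psi).
Implicit Types (x : M) (v : 'rV[R]_n) (Z W : M -> 'rV[R]_(2 + n)).

Lemma slice_compat x v Z W :
  differentiable_along_at Psi Z x -> differentiable_along_at Psi W x ->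
  dir_derive (fun q => G q (Z q) (W q)) x v =
  G x (nabla x v Z) (W x) + G x (Z x) (nabla x v W).
Proof.
have [_ _ mc] := D_lc; have [g_smooth _ _] := g_riem.
apply: pullback_connection_metric => //.
- exact: near_dom (chart_at_dom x).
- have sgt := smooth_ambient_metric (delta := delta) alpha_smooth g_smooth.
  apply: (sgt (chart_at M x) 1%N).1.
  by exists (Psi x) => //; split => //; exact: chart_at_dom.
exact: differentiable_Psi.
Qed.

Lemma partial_t_differentiable x :
  differentiable_along_at Psi (fun _ => partial_t) x.
Proof.
apply: differentiable_along_parts; rewrite partialE;
  [exact: smooth_fun_cst|exact: smooth_fun_cst|exact: smooth_vfield0].
Qed.

Lemma xi_smooth : [/\ smooth_fun setT (fun q => vt (xi q)),
  smooth_fun setT (fun q => vr (xi q)) & smooth_vfield setT (fun q => rsubmx (xi q))].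
Proof.
split.
- rewrite (_ : (fun q => _) = fun q => expR (u q)); first exact: smooth_fun_expR.
  by apply/funext => q; rewrite /xi_field vtZ partialE mulr1.
- rewrite (_ : (fun q => _) = fun=> 0); first exact: smooth_fun_cst.
  by apply/funext => q; rewrite /xi_field vrZ partialE mulr0.
rewrite (_ : (fun q => _) = fun=> 0); first exact: smooth_vfield0.
by apply/funext => q; rewrite /xi_field rsubmxZ partialE scaler0.
Qed.

Lemma xi_differentiable x : differentiable_along_at Psi xi x.
Proof. by have [st sr sx] := xi_smooth; exact: differentiable_along_parts. Qed.

Let grad_norm_smooth : smooth_fun setT (fun q => bform (g q) (grad q) (grad q)).
Proof.
rewrite (_ : (fun q => _) = fun q => dir_derive u q (grad q)).
  by apply: dir_derive_smooth => //; exact: gradient_smooth.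
by apply/funext => q; rewrite (gradientP g_riem).
Qed.

Let exp_smooth (a : R) : smooth_fun setT (fun q => expR (a * u q)).
Proof. by apply: smooth_fun_expR; apply: smooth_funM => //; exact: smooth_fun_cst. Qed.

Lemma eta_smooth : [/\ smooth_fun setT (fun q => vt (eta q)),
  smooth_fun setT (fun q => vr (eta q)) &
  smooth_vfield setT (fun q => rsubmx (eta q))].
Proof.
split.
- rewrite (_ : (fun q => _) = fun q => expR (-1 * u q) *
      (bform (g q) (grad q) (grad q) * 2^-1)).
    apply: smooth_funM => //; apply: smooth_funM => //; exact: smooth_fun_cst.
  apply/funext => q; rewrite /eta_field !(vtD, vtN, vtZ) !partialE mulN1r.
  by rewrite !mulr0 mulr1 subr0 addr0.
- rewrite (_ : (fun q => _) = fun q => - expR (- 2 * u q)); first exact: smooth_funN.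
  apply/funext => q; rewrite /eta_field !(vrD, vrN, vrZ) !partialE.
  by rewrite !mulr0 mulr1 sub0r addr0.
rewrite (_ : (fun q => _) = fun q => expR (- 2 * u q) *: grad q).
  by apply: smooth_vfieldZ => //; exact: gradient_smooth.
apply/funext => q; rewrite /eta_field !(rsubmxD, rsubmxN, rsubmxZ) !partialE.
by rewrite !scaler0 subr0 add0r.
Qed.

Lemma eta_differentiable x : differentiable_along_at Psi eta x.
Proof. by have [st sr sx] := eta_smooth; exact: differentiable_along_parts. Qed.

(** Leibniz for e^u d_t: differentiating e^u restores exactly the t-component of dPsi(v) that
    [homothetic_field] subtracts. *)
Lemma nabla_xi x v : nabla x v xi = v *m differential Psi x.
Proof.
have du := smooth_fun_differentiable_at x u_smooth.
have de := smooth_fun_differentiable_at x (smooth_fun_expR u_smooth).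
rewrite /xi_field (pullback_connection_leibniz D v de (partial_t_differentiable x)).
have -> : dir_derive (fun q => expR (u q)) x v = expR (u x) * dir_derive u x v.
  have [_] := is_derive_expR_comp v du.
  by rewrite /= chart_mapK//; exact: chart_at_dom.
have -> : nabla x v (fun=> partial_t) = D (Psi x) (v *m differential Psi x)
    (const_field (M := N) (chart_at M x) partial_t).
  have ix := chart_at_dom x; rewrite pullback_connectionE.
  have ncst : {near chart_map M (chart_at M x) x,
      acomp Psi (chart_at M x) (fun=> partial_t) \o chart_inv M (chart_at M x) =1
      cst partial_t}.
    apply: near_chartW => // q iq.
    rewrite /= chart_mapK// (@acomp_Psi _ _ M delta u _ (fun=> partial_t) q iq).
    by rewrite /vcomp partialE mul0mx /partial_t row_mxKl.
  have D0 : 'D_v (acomp Psi (chart_at M x) (fun=> partial_t) \o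
      chart_inv M (chart_at M x)) (chart_map M (chart_at M x) x) = 0.
    by rewrite (near_eq_derive _ ncst) derive_cst.
  have tE : partial_t = delta_mx 0 (lshift n 0) :> 'rV[R]_(2 + n).
    by rewrite /partial_t delta_mx_lshift.
  rewrite (congr1 (fun w => w + _) D0) add0r [in LHS]tE -rowE rowK.
  by rewrite tE.
have H := homothetic_field D_lc g_riem alpha_sym alpha_unit (Psi x)
  (v *m differential Psi x).
(* [tcoord (Psi x)] is convertible to [expR (u x)], hence the cast. *)
rewrite [X in _ + X](H : expR (u x) *: _ = _).
have -> : vt (v *m differential Psi x) = expR (u x) * dir_derive u x v.
  by rewrite mul_differential_Psi// !ambient_vectE ?mxE /= mulr1.
by rewrite addrC subrK.
Qed.

Lemma normal_part_nabla_xi x v : normal_part gt Psi x (nabla x v xi) = 0.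
Proof.
have G_sym := ambient_metric_sym (delta := delta)
  (riemannian_sym g_riem) alpha_sym.
rewrite nabla_xi normal_partE// !(G_sym _ (v *m _)).
by rewrite xi_tangent// eta_tangent// oppr0 !scale0r subr0.
Qed.

Lemma normal_part_nabla_eta x v : normal_part gt Psi x (nabla x v eta) = 0.
Proof.
have G_sym := ambient_metric_sym (delta := delta)
  (riemannian_sym g_riem) alpha_sym.
have e1 := slice_compat v (eta_differentiable x) (eta_differentiable x).
have e2 := slice_compat v (xi_differentiable x) (eta_differentiable x).
rewrite normal_partE//.
have -> : G x (nabla x v eta) (eta x) = 0.
  move: e1; rewrite (_ : (fun q => _) = fun=> 0); last first.
    by apply/funext => q; exact: eta_lightlike.
  rewrite dir_derive_cst (G_sym _ (eta x)) => /eqP.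
  by rewrite eq_sym -mulr2n mulrn_eq0 /= => /eqP.
have -> : G x (nabla x v eta) (xi x) = 0.
  move: e2; rewrite (_ : (fun q => _) = fun=> -1); last first.
    by apply/funext => q; exact: xi_eta.
  rewrite dir_derive_cst nabla_xi (G_sym _ (v *m _)) eta_tangent// add0r.
  by rewrite (G_sym _ (xi x)).
by rewrite oppr0 !scale0r subr0.
Qed.

Lemma normal_part_nabla_frame x v (a b : M -> R) :
  smooth_fun setT a -> smooth_fun setT b ->
  normal_part gt Psi x (nabla x v (fun q => a q *: xi q + b q *: eta q)) =
  dir_derive a x v *: xi x + dir_derive b x v *: eta x.
Proof.
move=> sa sb.
have scale_diff (f : M -> R) Z : smooth_fun setT f ->
    [/\ smooth_fun setT (fun q => vt (Z q)), smooth_fun setT (fun q => vr (Z q)) &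
      smooth_vfield setT (fun q => rsubmx (Z q))] ->
    differentiable_along_at Psi (fun q => f q *: Z q) x.
  move=> sf [st sr sx]; apply: differentiable_along_parts.
  - by under eq_fun do rewrite vtZ; exact: smooth_funM.
  - by under eq_fun do rewrite vrZ; exact: smooth_funM.
  by under eq_fun do rewrite rsubmxZ; exact: smooth_vfieldZ.
have da := smooth_fun_differentiable_at x sa.
have db := smooth_fun_differentiable_at x sb.
have lin (c1 c2 c3 c4 : R) w1 w2 w3 w4 :
    normal_part gt Psi x (c1 *: w1 + c2 *: w2 + (c3 *: w3 + c4 *: w4)) =
    c1 *: normal_part gt Psi x w1 + c2 *: normal_part gt Psi x w2 +
    (c3 *: normal_part gt Psi x w3 + c4 *: normal_part gt Psi x w4).
  by rewrite /normal_part !mulmxDl !scalemxAl.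
rewrite (pullback_connectionD D v (scale_diff _ _ sa xi_smooth)
  (scale_diff _ _ sb eta_smooth)).
rewrite (pullback_connection_leibniz D v da (xi_differentiable x)).
rewrite (pullback_connection_leibniz D v db (eta_differentiable x)).
rewrite lin normal_part_nabla_xi normal_part_nabla_eta !scaler0 !addr0.
rewrite (normal_part_id g_riem alpha0 u_smooth (xi_normal _ _ alpha0 u_smooth x)).
by rewrite (normal_part_id g_riem alpha0 u_smooth (eta_normal _ g_riem alpha0 u_smooth x)).
Qed.

Lemma metric_xi_smooth Z : smooth_along Psi Z ->
  smooth_fun setT (fun q => G q (Z q) (xi q)).
Proof.
move=> /smooth_along_parts[st sr sx]; have [xt xr _] := xi_smooth.
rewrite (_ : (fun q => _) = fun q => expR (u q) *
    (vt (Z q) * vr (xi q) + vr (Z q) * vt (xi q))).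
  apply: smooth_funM; first exact: smooth_fun_expR.
  by apply: smooth_funD; exact: smooth_funM.
apply/funext => q; rewrite metric_slice// {5}/xi_field rsubmxZ partialE.
by rewrite scaler0 bform0r mulr0 addr0.
Qed.

Lemma metric_eta_smooth Z : smooth_along Psi Z ->
  smooth_fun setT (fun q => G q (Z q) (eta q)).
Proof.
move=> /smooth_along_parts[st sr sx]; have [et er _] := eta_smooth.
have g_sym := riemannian_sym g_riem.
(* The weight e^{2u} of the slice metric cancels the e^{-2u} in front of the gradient, leaving du
   applied to the spatial part of [Z]. *)
rewrite (_ : (fun q => _) = fun q => expR (u q) *
    (vt (Z q) * vr (eta q) + vr (Z q) * vt (eta q)) +
    dir_derive u q (rsubmx (Z q))).
  apply: smooth_funD; last exact: dir_derive_smooth.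
  apply: smooth_funM; first exact: smooth_fun_expR.
  by apply: smooth_funD; exact: smooth_funM.
apply/funext => q; rewrite metric_slice//; congr (_ + _).
have -> : rsubmx (eta q) = expR (- 2 * u q) *: grad q.
  rewrite /eta_field !(rsubmxD, rsubmxN, rsubmxZ) !partialE.
  by rewrite !scaler0 subr0 add0r.
rewrite bformZr bform_sym// (gradientP g_riem)// mulrA expr2 -!expRD.
by rewrite (_ : _ + _ = 0) ?expR0 ?mul1r//; ring.
Qed.

End NormalConnection.

Theorem corollary4p3 (R : realType) (n : nat) (M : manifold R n)
    (c : set (tensor02 M)) (g : tensor02 M) (alpha : R -> tensor11 M)
    (delta : {posnum R}) (D : connection (ambient M delta)) (u : M -> R)
    (n_ge2 : (2 <= n)%N)
    (c_conf : conformal_structure c)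
    (cg : c g)
    (alpha_adm : admissible c alpha)
    (alpha_delta : nonsingular_below alpha delta%:num)
    (D_lc : levi_civita (ambient_metric delta g alpha) D)
    (u_smooth : smooth_fun setT u) :
  let gt := ambient_metric delta g alpha in
  let Psi_u := Psi delta u in
  [/\ normal_parallel gt D Psi_u (xi_field u),
      normal_parallel gt D Psi_u (eta_field g u) &
      forall V W Z,
        smooth_vfield setT V -> smooth_vfield setT W ->
        smooth_along Psi_u Z -> normal_field gt Psi_u Z ->
        forall x, normal_curvature gt D Psi_u V W Z x = 0].
Proof.
move=> gt Psi_u.
have g_riem : riemannian g.
  by have [g0 _ cE] := c_conf; move: cg; rewrite cE => -[].
have [alpha_smooth alpha_sa alpha0 _] := alpha_adm.
have alpha_sym r x a b := alpha_sa g cg r x a b.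
split=> [V _ x|V _ x|V W Z sV sW sZ nZ x].
- exact: normal_part_nabla_xi.
- exact: normal_part_nabla_eta.
pose a q := - bform (gt (Psi_u q)) (Z q) (eta_field g u q).
pose b q := - bform (gt (Psi_u q)) (Z q) (xi_field u q).
have sa : smooth_fun setT a.
  by apply: smooth_funN; exact: metric_eta_smooth.
have sb : smooth_fun setT b.
  by apply: smooth_funN; exact: metric_xi_smooth.
(* An equality of fields with arbitrary coefficients: the outer connection differentiates the result
   of the inner one, whose coefficients are already derivatives of [a] and [b]. *)
have frame X (a' b' : M -> R) : smooth_fun setT a' -> smooth_fun setT b' ->
    normal_connection gt D Psi_u X (fun q => a' q *: xi_field u q + b' q *: eta_field g u q) =
    (fun q => dir_derive a' q (X q) *: xi_field u q +
              dir_derive b' q (X q) *: eta_field g u q).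
  by move=> sa' sb'; apply/funext => q; exact: normal_part_nabla_frame.
(* A normal field is its own normal part, which [normal_partE] expands in the frame. *)
have -> : Z = (fun q => a q *: xi_field u q + b q *: eta_field g u q).
  apply/funext => q; rewrite -[LHS](normal_part_id g_riem alpha0 u_smooth (nZ q)).
  by rewrite (normal_partE _ g_riem alpha0 u_smooth) -scaleNr.
have sX (X : vfield M) (f : M -> R) : smooth_vfield setT X -> smooth_fun setT f ->
    smooth_fun setT (fun q => dir_derive f q (X q)).
  by move=> sX' sf; exact: dir_derive_smooth.
rewrite /normal_curvature !frame //; try exact: sX.
rewrite (dir_derive_lie_bracket x sa sV sW) (dir_derive_lie_bracket x sb sV sW).
have cancel (p q r s : R) (X Y : 'rV[R]_(2 + n)) :
    p *: X + q *: Y - (r *: X + s *: Y) - ((p - r) *: X + (q - s) *: Y) = 0.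
  by rewrite !scalerBl opprD addrACA subrr.
exact: cancel.
Qed.
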